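(* Let $K$ be a field, let $t\geq 0$ be an integer, and let $\Delta$ be a $\mathrm{CM}_t$ simplicial complex. Let $\Gamma$ be the contraction of $\Delta$ by $\alpha=(k_1,\ldots,k_m)$, where $\alpha$ is the vector obtained from contraction. If $k_i\geq t$ for all $i$ and $\Gamma$ is pure, then $\Gamma$ is Buchsbaum.
   Context: Cohen-Macaulayness of simplicial complexes is over the fixed field $K$. For a face $F$ of a simplicial complex $\Delta$, $\mathrm{link}_\Delta(F)=\{G\in\Delta : G\cap F=\emptyset,\ G\cup F\in\Delta\}$. For an integer $t\ge 0$, $\Delta$ is called $\mathrm{CM}_t$ if $\Delta$ is pure and $\mathrm{link}_\Delta(F)$ is Cohen-Macaulay for every face $F\in\Delta$ with $\#(F)\geq t$. $\mathrm{CM}_0$ is the same as Cohen-Macaulay, and $\mathrm{CM}_1$ is the same as Buchsbaum. Contraction: let $\Delta=\langle F_1,\ldots,F_r\rangle$ be a simplicial complex with facets $F_1,\dots,F_r$. Define an equivalence relation on the vertices of $\Delta$ by $x_i\sim x_j$ if and only if $\langle x_i\rangle\ast\mathrm{link}_\Delta(x_i)=\langle x_j\rangle\ast\mathrm{link}_\Delta(x_j)$ ($\ast$ denotes the join); equivalently, for each facet $F\in\Delta$, $F$ contains $x_i$ if and only if $F$ contains $x_j$. Let $\bar y_1,\ldots,\bar y_m$ be the equivalence classes and let $\alpha=(k_1,\ldots,k_m)$, where $k_i$ is the cardinality of $\bar y_i$. For each facet $F_s$ put $G_s=\{\bar y_i : \bar y_i\subset F_s\}$. The contraction of $\Delta$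 by $\alpha$ is the simplicial complex $\Gamma$ on the vertex set $\{\bar y_1,\ldots,\bar y_m\}$ with facets $G_1,\ldots,G_r$, and $\alpha$ is called the vector obtained from contraction. *)

(* Defs.v *)
From mathcomp Require Import all_boot all_order all_algebra.
From mathcomp Require Import mpoly.

Set Implicit Arguments.
Unset Strict Implicit.
Unset Printing Implicit Defensive.

Import GRing.Theory.
Local Open Scope ring_scope.

Definition max_of (P : nat -> Prop) (d : nat) : Prop :=
  P d /\ forall e, P e -> (e <= d)%N.

(* An ideal [I] of [A] stands for the quotient ring [A / I]: ideals of [A / I]
   are ideals of [A] containing [I], and [x = 0] in [A / I] is [I x].         *)
Section QuotientRings.
Variable A : comNzRingType.
Implicit Types (I J : A -> Prop) (s : seq A).

Definition is_ideal I : Prop :=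
  [/\ I 0, forall x y, I x -> I y -> I (x + y) & forall a x, I x -> I (a * x)].

Definition is_prime_ideal I : Prop :=
  [/\ is_ideal I, ~ I 1 & forall x y, I (x * y) -> I x \/ I y].

Definition ideal_gen (S : A -> Prop) (x : A) : Prop :=
  exists cs : seq (A * A),
    (forall c, c \in cs -> S c.2) /\ x = \sum_(c <- cs) c.1 * c.2.

(* p 0 < p 1 < ... < p n, a strict chain of n + 1 primes of A / I *)
Definition has_prime_chain I (n : nat) : Prop :=
  exists p : nat -> A -> Prop,
    (forall i, (i <= n)%N -> is_prime_ideal (p i) /\ forall x, I x -> p i x) /\
    (forall i, (i < n)%N ->
       (forall x, p i x -> p i.+1 x) /\ exists2 x, p i.+1 x & ~ p i x).

Definition krull_dim I (d : nat) : Prop := max_of (has_prime_chain I) d.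

Definition add_gens I s : A -> Prop := ideal_gen (fun x => I x \/ x \in s).

Definition regular_seq I s : Prop :=
  (forall i, (i < size s)%N ->
     forall x, add_gens I (take i s) (s`_i * x) -> add_gens I (take i s) x) /\
  ~ add_gens I s 1.

(* depth of A / I with respect to the image of the ideal m *)
Definition depth_in (m : A -> Prop) I (d : nat) : Prop :=
  max_of (fun n => exists s, [/\ size s = n,
                                 forall x, x \in s -> m x & regular_seq I s]) d.

End QuotientRings.

(* Faces are subsets of a finite ground type [V]; elements of [V] need not be
   vertices of the complex, so that a link lives over the same ground type.   *)
Section Complexes.
Variable V : finType.
Implicit Types (D E : {set {set V}}) (F G : {set V}) (x y : V).

Definition simplicial_complex D : Prop :=
  set0 \in D /\ forall F G, G \in D -> F \subset G -> F \in D.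

Definition vertices D : {set V} := [set x | [set x] \in D].

Definition facets D : {set {set V}} :=
  [set F in D | [forall G in D, (F \subset G) ==> (F == G)]].

Definition pure D : Prop :=
  forall F G, F \in facets D -> G \in facets D -> #|F| = #|G|.

Definition link D F : {set {set V}} :=
  [set G in D | [disjoint G & F] && (G :|: F \in D)].

Definition complex_join D E : {set {set V}} := [set F :|: G | F in D, G in E].

Definition complex_spanned (Fs : {set {set V}}) : {set {set V}} :=
  [set F : {set V} | [exists G in Fs, F \subset G]].

(* the complex <x> * link(x) *)
Definition star_join D x : {set {set V}} :=
  complex_join (complex_spanned [set [set x]]) (link D [set x]).

Definition vertex_classes D : {set {set V}} :=
  equivalence_partition (fun x y => star_join D x == star_join D y)
                        (vertices D).

Definition contraction_vector D : seq nat :=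
  [seq #|y| | y : {set V} <- enum (vertex_classes D)].

End Complexes.

(* The vertices of the contraction are the classes, so its ground type is
   [{set V}].                                                                 *)
Definition contraction (V : finType) (D : {set {set V}}) : {set {set {set V}}} :=
  complex_spanned
    [set [set y in vertex_classes D | y \subset F] | F : {set V} in facets D].

Section CohenMacaulay.
Variables (K : fieldType) (V : finType).
Implicit Types (D : {set {set V}}).

Definition face_monomial (F : {set V}) : {mpoly K[#|V|]} :=
  \prod_(v in F) 'X_(enum_rank v).

(* Variables outside [vertices D] are among the generators, so the quotient is
   the usual Stanley-Reisner ring on the vertices of D.                       *)
Definition stanley_reisner_ideal D : {mpoly K[#|V|]} -> Prop :=
  ideal_gen (fun p => exists2 F, F \notin D & p = face_monomial F).

Definition irrelevant_ideal : {mpoly K[#|V|]} -> Prop :=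
  ideal_gen (fun p => exists i, p = 'X_i).

(* depth K[D] = dim K[D], with depth taken, as usual for graded rings, at the
   irrelevant maximal ideal.                                                  *)
Definition cohen_macaulay D : Prop :=
  exists d, krull_dim (stanley_reisner_ideal D) d /\
            depth_in irrelevant_ideal (stanley_reisner_ideal D) d.

Definition CM (t : nat) D : Prop :=
  pure D /\
  forall F, F \in D -> (t <= #|F|)%N -> cohen_macaulay (link D F).

Definition buchsbaum D : Prop := CM 1 D.

End CohenMacaulay.

Arguments cohen_macaulay K {V} D.
Arguments CM K {V} t D.
Arguments buchsbaum K {V} D.

(* Main.v *)
Require Import Defs.
From mathcomp Require Import all_boot all_order all_algebra.
From mathcomp Require Import mpoly.
From mathcomp Require Import ring zify.

(* Let [G] be a nonempty face of the contraction and [F] the union of the classes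
   in [G], so that [#|F| >= t] and the link [L] of [F] is Cohen-Macaulay.  The link
   [L'] of [G] is the subcomplex of [L] induced on a set [B] of representatives of
   the classes, hence K[L'] is an algebra retract of K[L].  Purity of both
   complexes says that every facet of [L] has the same number d' of vertices in [B]
   and the same number d'' outside [B].  The elementary symmetric polynomials of
   degrees 1..d' in the variables of [B] and 1..d'' in the others are therefore a
   system of parameters of K[L] of length dim K[L].  As K[L] is Cohen-Macaulay, it
   is a regular sequence, and its first d' members, which lie in the retract, stay
   regular on K[L'], whose dimension is d'.
   Regularity is obtained from Koszul complexes: a regular sequence of length n in
   the radical of the ideal of n elements makes their Koszul complex acyclic, and
   for homogeneous elements of positive degree Nakayama's lemma turns this into
   regularity.                                                                *)

Set Implicit Arguments.
Unset Strict Implicit.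
Unset Printing Implicit Defensive.

Import GRing.Theory.
Local Open Scope ring_scope.

(** * Choice over finite index sets *)

Lemma bits_choice (T : Type) (P : seq bool -> T -> Prop) n :
  (forall u, size u = n -> exists x, P u x) ->
  exists w, forall u, size u = n -> P u (w u).
Proof.
elim: n P => [|n IHn] P exP.
  by have [x Px] := exP [::] erefl; exists (fun=> x) => -[].
have [b|w1 w1P] := IHn (fun u => P (true :: u)).
  by move=> sz_b; apply: exP; rewrite /= sz_b.
have [b|w0 w0P] := IHn (fun u => P (false :: u)).
  by move=> sz_b; apply: exP; rewrite /= sz_b.
exists (fun u => if head false u then w1 (behead u) else w0 (behead u)).
by move=> [|[] u] // [sz_u]; [apply: w1P | apply: w0P].
Qed.

Lemma seq_choice (T : Type) (P : nat -> T -> Prop) (x0 : T) n :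
  (forall i, (i < n)%N -> exists x, P i x) ->
  exists s, size s = n /\ forall i, (i < n)%N -> P i (nth x0 s i).
Proof.
elim: n => [|n IHn] exP; first by exists [::].
have [i lt_in|s [sz_s sP]] := IHn; first by apply: exP; apply: ltnW.
have [x Px] := exP n (leqnn _).
exists (rcons s x); split=> [|i]; first by rewrite size_rcons sz_s.
rewrite ltnS leq_eqVlt nth_rcons sz_s => /orP[/eqP->|lt_in].
  by rewrite ltnn eqxx.
by rewrite lt_in; apply: sP.
Qed.

(** * Ideals and regular sequences *)

Section Ideals.
Variable A : comNzRingType.
Implicit Types (I J : A -> Prop) (S : A -> Prop) (s t : seq A).

Lemma ideal0 I : is_ideal I -> I 0. Proof. by case. Qed.

Lemma idealD I x y : is_ideal I -> I x -> I y -> I (x + y).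
Proof. by case=> _ + _; apply. Qed.

Lemma ideal_mull I a x : is_ideal I -> I x -> I (a * x).
Proof. by case=> _ _; apply. Qed.

Lemma ideal_mulr I a x : is_ideal I -> I x -> I (x * a).
Proof. by rewrite mulrC; apply: ideal_mull. Qed.

Lemma idealN I x : is_ideal I -> I x -> I (- x).
Proof. by rewrite -mulN1r; apply: ideal_mull. Qed.

Lemma idealB I x y : is_ideal I -> I x -> I y -> I (x - y).
Proof. by move=> idI Ix Iy; apply: idealD => //; apply: idealN. Qed.

Lemma ideal_sum I (T : Type) (r : seq T) (P : pred T) (F : T -> A) :
  is_ideal I -> (forall i, P i -> I (F i)) -> I (\sum_(i <- r | P i) F i).
Proof.
by move=> idI IF; elim/big_ind: _ => //; [apply: ideal0 | move=> *; apply: idealD].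
Qed.

Lemma ideal_gen_ideal S : is_ideal (ideal_gen S).
Proof.
split; first by exists [::]; rewrite big_nil.
  move=> x y [cs [Scs ->]] [ds [Sds ->]]; exists (cs ++ ds); split.
    by move=> c; rewrite mem_cat => /orP[/Scs|/Sds].
  by rewrite big_cat.
move=> a x [cs [Scs ->]]; exists [seq (a * c.1, c.2) | c <- cs]; split.
  by move=> c /mapP[e /Scs Se ->].
by rewrite big_map mulr_sumr; apply: eq_bigr => c _; rewrite mulrA.
Qed.

Lemma ideal_gen_mem S x : S x -> ideal_gen S x.
Proof.
move=> Sx; exists [:: (1, x)]; split; last by rewrite big_seq1 mul1r.
by move=> c; rewrite inE => /eqP->.
Qed.

Lemma ideal_gen_min S I x :
  is_ideal I -> (forall y, S y -> I y) -> ideal_gen S x -> I x.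
Proof.
move=> idI SI [cs [Scs ->]]; rewrite big_seq; apply: ideal_sum => // c /Scs Sc.
by apply: ideal_mull => //; apply: SI.
Qed.

Lemma add_gens_ideal I s : is_ideal (add_gens I s).
Proof. exact: ideal_gen_ideal. Qed.

Lemma add_gens_sub I s x : I x -> add_gens I s x.
Proof. by move=> Ix; apply: ideal_gen_mem; left. Qed.

Lemma add_gens_mem I s x : x \in s -> add_gens I s x.
Proof. by move=> sx; apply: ideal_gen_mem; right. Qed.

Lemma add_gens_min I J s x : is_ideal J -> (forall y, I y -> J y) ->
  (forall y, y \in s -> J y) -> add_gens I s x -> J x.
Proof. by move=> idJ IJ sJ; apply: ideal_gen_min => // y [/IJ|/sJ]. Qed.

Lemma add_gens0 I x : is_ideal I -> add_gens I [::] x <-> I x.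
Proof.
move=> idI; split; last exact: add_gens_sub.
by apply: add_gens_min => // y.
Qed.

Lemma add_gens_cons I a s x :
  add_gens I (a :: s) x <-> add_gens (add_gens I [:: a]) s x.
Proof.
split; apply: add_gens_min; try exact: add_gens_ideal.
- by move=> y Iy; do 2![apply: add_gens_sub].
- move=> y; rewrite inE => /orP[/eqP->|]; last exact: add_gens_mem.
  by apply: add_gens_sub; apply: add_gens_mem; rewrite inE.
- move=> y; apply: add_gens_min; first exact: add_gens_ideal.
    by move=> z; apply: add_gens_sub.
  by move=> z; rewrite inE => /eqP->; apply: add_gens_mem; rewrite inE eqxx.
- by move=> y ys; apply: add_gens_mem; rewrite inE ys orbT.
Qed.

Fixpoint dot s t : A :=
  if s is a :: s' then if t is b :: t' then a * b + dot s' t' else 0 else 0.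

(** The elements with such a representation form an ideal that contains [I] and the entries of
    [t]. *)
Lemma add_gens_dot I t x : is_ideal I ->
  add_gens I t x -> exists2 s, size s = size t & I (x - dot s t).
Proof.
move=> idI; suff: is_ideal (fun x => exists2 s, size s = size t & I (x - dot s t)).
  move=> idJ; apply: (add_gens_min idJ) => y.
    move=> Iy; exists (nseq (size t) 0); first by rewrite size_nseq.
    suff ->: dot (nseq (size t) 0) t = 0 by rewrite subr0.
    by elim: (t) => //= a t' ->; rewrite mul0r addr0.
  move: idJ => _; elim: t => //= b t IHt; rewrite inE => /orP[/eqP->|/IHt].
    exists (1 :: nseq (size t) 0); first by rewrite /= size_nseq.
    suff /= ->: dot (nseq (size t) 0) t = 0.
      by rewrite mul1r addr0 subrr; apply: ideal0.
    by elim: (t) => //= a t' ->; rewrite mul0r addr0.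
  by case=> s sz_s Iy; exists (0 :: s); rewrite /= ?sz_s // mul0r add0r.
split.
- exists (nseq (size t) 0); first by rewrite size_nseq.
  suff ->: dot (nseq (size t) 0) t = 0 by rewrite subr0; apply: ideal0.
  by elim: (t) => //= a t' ->; rewrite mul0r addr0.
- move=> y z [s sz_s Iy] [s' sz_s' Iz].
  have [s2 sz_s2 Ds2] : exists2 s2, size s2 = size t & dot s2 t = dot s t + dot s' t.
    elim: (t) s s' sz_s sz_s' {Iy Iz} => [|b t' IHt] [|a s] [|a' s'] //=.
      by exists [::] => //; rewrite addr0.
    move=> [sz_s] [sz_s']; have [s2 sz_s2 Ds2] := IHt _ _ sz_s sz_s'.
    by exists (a + a' :: s2); rewrite /= ?sz_s2 // Ds2; ring.
  by exists s2 => //; rewrite Ds2 opprD addrACA; apply: idealD.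
- move=> a y [s sz_s Iy]; exists (map ( *%R a) s); first by rewrite size_map.
  suff ->: dot (map ( *%R a) s) t = a * dot s t.
    by rewrite -mulrBr; apply: ideal_mull.
  elim: s (t) {sz_s Iy} => [|b s IHs] [|c t'] //=; rewrite ?mulr0 //.
  by rewrite IHs; ring.
Qed.

Lemma add_gens1 I a x : is_ideal I ->
  add_gens I [:: a] x -> exists b, I (x - b * a).
Proof.
move=> idI /(add_gens_dot idI)[[|b [|]] //= _]; rewrite addr0 => Ix.
by exists b.
Qed.

Lemma regular_cons I a s : is_ideal I -> regular_seq I (a :: s) ->
  (forall x, I (a * x) -> I x) /\ regular_seq (add_gens I [:: a]) s.
Proof.
move=> idI [reg nt]; split.
  move=> x Iax; apply/(add_gens0 _ idI).
  by have := reg 0%N isT x; rewrite take0; apply; apply/add_gens0.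
split; last by move/(add_gens_cons I a s 1).
move=> i lt_is x /(add_gens_cons I a (take i s)) Ix.
exact/(add_gens_cons I a (take i s))/(reg i.+1 lt_is).
Qed.

(** In each binomial term either the exponent of [x] is at least [a] or that of [y] is at least
    [b]. *)
Lemma ideal_exp_add I x y a b : is_ideal I ->
  I (x ^+ a) -> I (y ^+ b) -> I ((x + y) ^+ (a + b)).
Proof.
move=> idI Ix Iy; rewrite exprDn; apply: ideal_sum => // i _.
rewrite -mulr_natr; apply: ideal_mulr => //.
have [lt_ib|le_bi] := ltnP i b.
  have ->: (a + b - i = a + (b - i))%N by rewrite addnBA // ltnW.
  by rewrite exprD; do 2![apply: ideal_mulr => //].
by rewrite -(subnK le_bi) [y ^+ _]exprD; do 2![apply: ideal_mull => //].
Qed.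

Lemma ideal_gen_exp I S x : is_ideal I -> (forall y, S y -> exists n, I (y ^+ n)) ->
  ideal_gen S x -> exists n, I (x ^+ n).
Proof.
move=> idI SI; suff idJ : is_ideal (fun x => exists n, I (x ^+ n)).
  exact: (@ideal_gen_min S (fun x => exists n, I (x ^+ n))).
split; first by exists 1%N; apply: ideal0.
  by move=> y z [a Ia] [b Ib]; exists (a + b)%N; apply: ideal_exp_add.
by move=> a y [n In]; exists n; rewrite exprMn; apply: ideal_mull.
Qed.

End Ideals.

(** * Koszul complexes *)

Section Koszul.
Variable A : comNzRingType.
Implicit Types (J : A -> Prop) (a ts : seq A) (u v : seq bool).
Implicit Types (b c : seq bool -> A).

(* The Koszul complex of [ts] is the exterior algebra on [size ts] generators,
   a function [c] on bit lists of length [size ts] standing for the sum over [u]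
   of [c u] times the wedge of the generators selected by [u].               *)
Fixpoint koszul_d ts c u : A :=
  match ts, u with
  | t :: ts', x :: u' =>
    if x then - koszul_d ts' (fun v => c (true :: v)) u'
    else koszul_d ts' (fun v => c (false :: v)) u' + t * c (true :: u')
  | _, _ => 0
  end.

(* wedge product on the left with the sum of [a_i e_i] *)
Fixpoint wedge a c u : A :=
  match a, u with
  | y :: a', x :: u' =>
    if x then y * c (false :: u') - wedge a' (fun v => c (true :: v)) u'
    else wedge a' (fun v => c (false :: v)) u'
  | _, _ => 0
  end.

Lemma koszul_dD ts b c u :
  koszul_d ts (fun v => b v + c v) u = koszul_d ts b u + koszul_d ts c u.
Proof.
elim: ts u b c => [|t ts IHts] [|[] u] b c //=; rewrite ?addr0 // !IHts; ring.
Qed.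

Lemma koszul_dZ ts x c u :
  koszul_d ts (fun v => x * c v) u = x * koszul_d ts c u.
Proof.
elim: ts u c => [|t ts IHts] [|[] u] c //=; rewrite ?mulr0 // !IHts; ring.
Qed.

Lemma koszul_dN ts c u : koszul_d ts (fun v => - c v) u = - koszul_d ts c u.
Proof.
by elim: ts u c => [|t ts IHts] [|[] u] c //=; rewrite ?oppr0 // !IHts; ring.
Qed.

Lemma koszul_d0 ts u : koszul_d ts (fun=> 0) u = 0.
Proof.
by elim: ts u => [|t ts IHts] [|[] u] //=; rewrite ?IHts ?mulr0 ?addr0 ?oppr0.
Qed.

Lemma koszul_d_ideal J ts c u : is_ideal J -> size u = size ts ->
  (forall v, size v = size ts -> J (c v)) -> J (koszul_d ts c u).
Proof.
move=> idJ; elim: ts u c => [|t ts IHts] [|x u] c //=; try by move=> *; apply: ideal0.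
move=> [sz_u] Jc; have Jd y: J (koszul_d ts (fun v => c (y :: v)) u).
  by apply: IHts => // v sz_v; apply: Jc; rewrite /= sz_v.
case: x; first exact: idealN.
by apply: idealD => //; apply: ideal_mull => //; apply: Jc; rewrite /= sz_u.
Qed.

Lemma koszul_d_gens J ts c u : is_ideal J -> (forall t, t \in ts -> J t) ->
  J (koszul_d ts c u).
Proof.
move=> idJ; elim: ts u c => [|t ts IHts] [|x u] c /= Jt; try exact: ideal0.
have Jd b: J (koszul_d ts b u) by apply: IHts => s ts_s; apply: Jt; rewrite inE ts_s orbT.
case: x; first exact: idealN.
by apply: idealD => //; apply: ideal_mulr => //; apply: Jt; rewrite inE eqxx.
Qed.

Lemma eq_koszul_d ts b c u : size u = size ts ->
  (forall v, size v = size ts -> b v = c v) -> koszul_d ts b u = koszul_d ts c u.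
Proof.
elim: ts u b c => [|t ts IHts] [|x u] b c //= [sz_u] eq_bc.
have eq_d y: koszul_d ts (fun v => b (y :: v)) u = koszul_d ts (fun v => c (y :: v)) u.
  by apply: IHts => // v sz_v; apply: eq_bc; rewrite /= sz_v.
by case: x; rewrite eq_d // eq_bc //= sz_u.
Qed.

Lemma koszul_dK ts c u : size u = size ts -> koszul_d ts (koszul_d ts c) u = 0.
Proof.
elim: ts u c => [|t ts IHts] [|[] u] c //= [sz_u].
  by rewrite koszul_dN IHts // opprK.
by rewrite koszul_dD koszul_dZ IHts // add0r mulrN subrr.
Qed.

(** The differential removes one generator from each wedge, hence the shift by one. With [P] a
    condition on the exterior degree, this lemma carries the grading of the Koszul complex. *)
Lemma koszul_d_cut ts (P : pred nat) c u : size u = size ts ->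
  koszul_d ts (fun v => if P (count id v) then c v else 0) u =
    if P (count id u).+1 then koszul_d ts c u else 0.
Proof.
elim: ts P u c => [|t ts IHts] P [|[] u] c //= => [_|[sz_u]|[sz_u]].
- by case: ifP.
- rewrite (IHts (fun k => P (1 + k)%N)) // add1n.
  by case: ifP => //; rewrite oppr0.
- rewrite (IHts (fun k => P (0 + k)%N)) // !add0n add1n.
  by case: ifP => //; rewrite mulr0 addr0.
Qed.

Lemma wedge_ideal J a c u : is_ideal J -> size u = size a ->
  (forall v, size v = size a -> J (c v)) -> J (wedge a c u).
Proof.
move=> idJ; elim: a u c => [|t a IHa] [|x u] c //=; try by move=> *; apply: ideal0.
move=> [sz_u] Jc; have Jd y: J (wedge a (fun v => c (y :: v)) u).
  by apply: IHa => // v sz_v; apply: Jc; rewrite /= sz_v.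
case: x => //.
by apply: idealB => //; apply: ideal_mull => //; apply: Jc; rewrite /= sz_u.
Qed.

Lemma wedgeD a b c u :
  wedge a (fun v => b v + c v) u = wedge a b u + wedge a c u.
Proof.
by elim: a u b c => [|t a IHa] [|[] u] b c //=; rewrite ?addr0 // !IHa; ring.
Qed.

Lemma wedgeZ a x c u : wedge a (fun v => x * c v) u = x * wedge a c u.
Proof.
by elim: a u c => [|t a IHa] [|[] u] c //=; rewrite ?mulr0 // !IHa; ring.
Qed.

Lemma wedgeN a c u : wedge a (fun v => - c v) u = - wedge a c u.
Proof.
by elim: a u c => [|t a IHa] [|[] u] c //=; rewrite ?oppr0 // !IHa; ring.
Qed.

Lemma wedge_supp a c i :
  (forall u, size u = size a -> (count id u < i)%N -> c u = 0) ->
  forall u, size u = size a -> (count id u < i.+1)%N -> wedge a c u = 0.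
Proof.
elim: a i c => [|t a IHa] i c c0 [|x u] //= [sz_u].
case: x => /=; last by rewrite add0n; apply: IHa => // v sz_v lt_vi; apply: c0 => //=; rewrite sz_v.
rewrite add1n ltnS => lt_ui; rewrite c0 /= ?sz_u // mulr0 add0r.
case: i lt_ui c0 => // i; rewrite ltnS => le_ui c0.
by rewrite (IHa i) ?oppr0 // => v sz_v lt_vi; apply: c0 => //=; rewrite sz_v.
Qed.

(** Left multiplication by the sum of the [a_i e_i] is a homotopy from zero to multiplication by
    [dot a ts]. Hence the ideal generated by [ts] annihilates Koszul homology. *)
Lemma koszul_homotopy a ts c u : size a = size ts -> size u = size ts ->
  koszul_d ts (wedge a c) u + wedge a (koszul_d ts c) u = dot a ts * c u.
Proof.
elim: ts a u c => [|t ts IHts] [|y a] [|[] u] c //=; rewrite ?addr0 ?mul0r //.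
  move=> [sz_a] [sz_u].
  rewrite koszul_dD koszul_dZ koszul_dN wedgeN.
  have := IHts a u (fun v => c (true :: v)) sz_a sz_u.
  by rewrite mulrDl => <-; ring.
move=> [sz_a] [sz_u].
rewrite wedgeD wedgeZ.
have := IHts a u (fun v => c (false :: v)) sz_a sz_u.
by rewrite mulrDl => <-; ring.
Qed.

Definition boundary_mod J ts c :=
  exists b, forall u, size u = size ts -> J (c u - koszul_d ts b u).

(* Induction on [fs]: by the case of [J + (f)], multiplication by the regular
   element [f] is injective on the Koszul homology of [A / J] in degrees at
   least [i], while a power of [f] kills it.                                  *)
Lemma koszul_vanish fs ts J i c :
    is_ideal J -> regular_seq J fs ->
    (forall f, f \in fs -> exists n, add_gens J ts (f ^+ n)) ->
    (size ts < i + size fs)%N ->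
    (forall u, size u = size ts -> (count id u < i)%N -> c u = 0) ->
    (forall u, size u = size ts -> J (koszul_d ts c u)) ->
  boundary_mod J ts c.
Proof.
elim: fs J i c => [|f fs IHfs] J i c idJ reg pow lt_ts supp cyc.
  (* With [fs] empty the bound says [size ts < i], so [c] vanishes in every degree. *)
  exists (fun=> 0) => u sz_u; rewrite koszul_d0 subr0 supp ?sz_u //.
    exact: ideal0.
  by rewrite addn0 in lt_ts; apply: leq_ltn_trans lt_ts; rewrite -sz_u count_size.
have [nzd regfs] := regular_cons idJ reg.
set J' := add_gens J [:: f] in regfs.
have idJ' : is_ideal J' by apply: add_gens_ideal.
have inj b : (forall u, size u = size ts -> (count id u < i)%N -> b u = 0) ->
    boundary_mod J ts (fun u => f * b u) -> boundary_mod J ts b.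
  move=> b0 [e eP].
  (* Since [f * b] lives in degrees at least [i], the components of [e] in degrees above [i] suffice
     to bound it. Dropping the others makes the induction hypothesis at [i.+1] applicable. *)
  pose e' u := if (i < count id u)%N then e u else 0.
  have e'P u : size u = size ts -> J (f * b u - koszul_d ts e' u).
    move=> sz_u; rewrite (koszul_d_cut (fun k => i < k)%N) // ltnS.
    case: leqP => [_|lt_ui]; first exact: eP.
    by rewrite b0 // mulr0 subr0; apply: ideal0.
  have [||||w wP] := IHfs J' i.+1 e' idJ' regfs.
  - move=> g g_fs; have [|n Jn] := pow g; first by rewrite inE g_fs orbT.
    exists n; apply: (add_gens_min (add_gens_ideal _ _)) Jn => y.
      by move=> Jy; do 2![apply: add_gens_sub].
    exact: add_gens_mem.
  - by rewrite addSnnS.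
  - by move=> u sz_u; rewrite ltnS => le_ui; rewrite /e' ltnNge le_ui.
  - move=> u sz_u; rewrite -[koszul_d _ _ _]opprK -[- koszul_d _ _ _](addrK (f * b u)).
    apply: idealN => //; apply: idealB => //.
      by apply: add_gens_sub; rewrite addrC; apply: e'P.
    by apply: ideal_mulr => //; apply: add_gens_mem; rewrite inE.
  (* Modulo [J], [e'] is the boundary of [w] plus [f * z]. So [f * b], the boundary of [e'], equals
     [f] times the boundary of [z], and [f] cancels. *)
  have [z zP] : exists z, forall u, size u = size ts ->
      J (e' u - koszul_d ts w u - z u * f).
    apply: (@bits_choice _ (fun u y => J (e' u - koszul_d ts w u - y * f))) => u.
    by move=> /wP /(add_gens1 idJ).
  exists z => u sz_u; apply: nzd.
  have := koszul_d_ideal idJ sz_u zP.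
  have -> : koszul_d ts (fun v => e' v - koszul_d ts w v - z v * f) u =
            koszul_d ts e' u - f * koszul_d ts z u.
    rewrite koszul_dD koszul_dN koszul_dD koszul_dN koszul_dK // subr0.
    by rewrite -koszul_dZ; congr (_ - _); apply: eq_koszul_d => // v _; apply: mulrC.
  move=> /(idealD idJ (e'P u sz_u)); congr J; ring.
have [|n Jn] := pow f; first by rewrite inE eqxx.
have [a sz_a Ja] := add_gens_dot idJ Jn.
(* As [f ^+ n] equals [dot a ts] modulo [J], the homotopy shows that [f ^+ n * c] bounds; [inj] then
   strips the factors [f] one at a time. *)
have : boundary_mod J ts (fun u => f ^+ n * c u).
  exists (wedge a c) => u sz_u; rewrite -[f ^+ n](subrK (dot a ts)) mulrDl.
  rewrite -(koszul_homotopy c sz_a sz_u) -addrA [_ + wedge _ _ _]addrC addrK.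
  apply: idealD => //; first exact: ideal_mulr.
  by apply: wedge_ideal => //; rewrite ?sz_a.
elim: n {Jn Ja} => [|n IHn]; case=> b bP.
  by exists b => u /bP; rewrite expr0 mul1r.
apply: IHn; apply: inj => [u sz_u lt_ui|]; first by rewrite supp // mulr0.
by exists b => u /bP; rewrite exprS mulrA.
Qed.

(** The function [v => (count id v == 0)%:R] is the unit of the exterior algebra, so its wedge with
    [a] is the degree one chain with coefficients [a]. *)
Lemma koszul_d_lin a ts u : size a = size ts -> size u = size ts ->
  koszul_d ts (wedge a (fun v => (count id v == 0)%:R)) u =
    dot a ts * (count id u == 0)%:R.
Proof.
move=> sz_a sz_u; set z := fun v => _.
rewrite -(koszul_homotopy z sz_a sz_u) -[LHS]addr0; congr (_ + _).
apply/esym; apply: (@wedge_ideal (fun x => x = 0)); rewrite ?sz_a //.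
  by split=> // [x y -> ->|x y ->]; rewrite ?addr0 ?mulr0.
move=> v sz_v; have := koszul_d_cut (pred1 0%N) (fun=> 1) sz_v => /= <-.
by apply: eq_koszul_d => // w _; rewrite /z; case: eqP.
Qed.

(** Vanishing of the Koszul homology of [A / J] in all positive degrees. The condition at the
    all-false list discards degree 0, where the homology is the quotient by [J] and [ts]. *)
Definition acyclic_mod J ts :=
  forall c, c (nseq (size ts) false) = 0 ->
    (forall u, size u = size ts -> J (koszul_d ts c u)) -> boundary_mod J ts c.

Lemma count_nseq_false n : count id (nseq n false) = 0%N.
Proof. by elim: n => //= n ->. Qed.

Lemma count_id_eq0 u : (count id u == 0%N) -> u = nseq (size u) false.
Proof. by elim: u => // -[] u IHu //= /IHu {1}->. Qed.

(** A relation [t * x = dot a ts] modulo [J] is a cycle of degree one with coefficients [x] and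
    [- a]. As it bounds, its coefficient [x] at the generator of [t] lies in the ideal of [J] and
    [ts]. *)
Lemma acyclic_nzd J t ts x : is_ideal J -> acyclic_mod J (t :: ts) ->
  add_gens J ts (t * x) -> add_gens J ts x.
Proof.
move=> idJ acyc /(add_gens_dot idJ)[a sz_a Ja].
pose z v : A := (count id v == 0)%:R.
pose c u := if head false u then x * z (behead u) else - wedge a z (behead u).
have [||b bP] := acyc c.
- rewrite /c /= (wedge_supp (i := 0)) ?oppr0 ?size_nseq //.
  by rewrite count_nseq_false.
- move=> [|y u] //= [sz_u]; rewrite /c /=.
  case: y; first rewrite koszul_dZ.
    have -> : koszul_d ts z u = 0.
      have := koszul_d_cut (pred1 0%N) (fun=> 1) sz_u => /= <-.
      by apply: eq_koszul_d => // w _; rewrite /z; case: eqP.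
    by rewrite mulr0 oppr0; apply: ideal0.
  rewrite koszul_dN koszul_d_lin // mulrA -mulNr -mulrDl addrC.
  exact: ideal_mulr.
have := bP (true :: nseq (size ts) false).
rewrite /= size_nseq /c /= /z count_nseq_false mulr1 opprK => /(_ erefl) Jx.
rewrite -[x](addrK (koszul_d ts (fun v => b (true :: v)) (nseq (size ts) false))).
apply: idealB; first exact: add_gens_ideal.
  exact: add_gens_sub.
by apply: koszul_d_gens => [|t' /add_gens_mem]; first exact: add_gens_ideal.
Qed.

(* In the long exact sequence of the mapping cone of [t], vanishing of H_1 of
   [t :: ts] says that H_1 of [ts] is divisible by [t].                       *)
Lemma acyclic_divisible J t ts c : is_ideal J -> acyclic_mod J (t :: ts) ->
    c (nseq (size ts) false) = 0 ->
    (forall u, size u = size ts -> J (koszul_d ts c u)) ->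
  exists b0 b1,
   [/\ forall u, size u = size ts -> J (c u - (koszul_d ts b0 u + t * b1 u)),
       b1 (nseq (size ts) false) = 0
     & forall u, size u = size ts -> J (koszul_d ts b1 u)].
Proof.
move=> idJ acyc c0 cyc.
pose c' u := if head false u then 0 else c (behead u).
have [|[|[] u] //= [sz_u]|b bP] := acyc c'; rewrite /c' //=.
- by rewrite koszul_d0 oppr0; apply: ideal0.
- by rewrite mulr0 addr0; apply: cyc.
(* Keeping only degrees at least 2 leaves [b1] without a component of degree 0. *)
pose b' u := if (1 < count id u)%N then b u else 0.
have b'P u : size u = size (t :: ts) -> J (c' u - koszul_d (t :: ts) b' u).
  move=> sz_u; rewrite (koszul_d_cut (fun k => 1 < k)%N) // ltnS.
  case: ltnP => [_|]; first exact: bP.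
  rewrite leqn0 => /count_id_eq0 ->; rewrite sz_u /c' /= c0 subr0; exact: ideal0.
exists (fun u => b' (false :: u)), (fun u => b' (true :: u)); split.
- by move=> u sz_u; apply: (b'P (false :: u)); rewrite /= sz_u.
- by rewrite /b' /= count_nseq_false.
- move=> u sz_u; have := b'P (true :: u); rewrite /= sz_u => /(_ erefl).
  by rewrite /c' /= opprK add0r.
Qed.

End Koszul.

(** * Graded Nakayama *)

Section GradedNakayama.
Variables (K : fieldType) (n : nat).
Local Notation R := {mpoly K[n]}.
Implicit Types (J : R -> Prop) (p t : R) (ts : seq R) (c : seq bool -> R).
Implicit Types (ks : seq nat) (u : seq bool).

Definition homogeneous J := forall e p, J p -> J (pihomog mdeg e p).

(** The coefficient of a wedge of weight [w] in the component of total degree [e] of a chain, hence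
    zero when [w] exceeds [e]. *)
Definition shifted_part e w p := if (w <= e)%N then pihomog mdeg (e - w) p else 0.

Lemma shifted_partD e w p q :
  shifted_part e w (p + q) = shifted_part e w p + shifted_part e w q.
Proof. by rewrite /shifted_part; case: ifP; rewrite ?addr0 // raddfD. Qed.

Lemma shifted_partN e w p : shifted_part e w (- p) = - shifted_part e w p.
Proof. by rewrite /shifted_part; case: ifP; rewrite ?oppr0 // raddfN. Qed.

Lemma shifted_part_ideal J e w p : is_ideal J -> homogeneous J -> J p ->
  J (shifted_part e w p).
Proof.
by move=> idJ homJ Jp; rewrite /shifted_part; case: ifP => _; [apply: homJ | apply: ideal0].
Qed.

Lemma pihomogM k e t p : t \is k.-homog ->
  pihomog mdeg e (t * p) = if (k <= e)%N then t * pihomog mdeg (e - k) p else 0.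
Proof.
move=> hom_t; pose N := maxn (mmeasure mdeg p) e.+1.
rewrite {1}(@pihomog_partitionE _ _ mdeg N p) ?leq_maxl // mulr_sumr raddf_sum /=.
have homM d : t * pihomog mdeg d p \is (k + d).-homog.
  by apply: dhomogM; rewrite ?hom_t ?pihomogP.
case: leqP => [le_ke|lt_ek].
  have lt_N : (e - k < N)%N by rewrite /N; lia.
  rewrite (bigD1 (Ordinal lt_N)) //= pihomog_dE; last first.
    by have := homM (e - k)%N; rewrite subnKC.
  rewrite big1 ?addr0 // => d /eqP ne_d; apply: pihomog_ne0 (homM d).
  by apply/eqP => eq_d; apply: ne_d; apply: val_inj; rewrite /= -eq_d addKn.
rewrite big1 // => d _; apply: pihomog_ne0 (homM d).
by rewrite neq_ltn (leq_trans lt_ek) ?orbT ?leq_addr.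
Qed.

Lemma shifted_partM k e w t p : t \is k.-homog ->
  shifted_part e w (t * p) = t * shifted_part e (w + k) p.
Proof.
move=> hom_t; rewrite /shifted_part.
case: (leqP w e) => [le_we|lt_ew].
  rewrite (pihomogM _ _ hom_t) subnDA leq_subRL //.
  by case: ifP => // _; rewrite mulr0.
by rewrite leqNgt (leq_trans lt_ew) ?leq_addr // mulr0.
Qed.

Fixpoint weight ks u : nat :=
  match ks, u with
  | k :: ks', x :: u' => (if x then k else 0) + weight ks' u'
  | _, _ => 0
  end.

Local Notation homog_seq := (all2 (fun k (t : R) => t \is k.-homog)).

(** The differential trades a generator of degree [k] for a coefficient of degree [k], so it
    preserves the total degree. *)
Lemma koszul_shifted_part ks ts e w c u : homog_seq ks ts -> size u = size ts ->
  shifted_part e (w + weight ks u) (koszul_d ts c u) =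
    koszul_d ts (fun v => shifted_part e (w + weight ks v) (c v)) u.
Proof.
elim: ts ks w u c => [|t ts IHts] [|k ks] w [|x u] c //=.
  by move=> _ _; rewrite /shifted_part; case: ifP; rewrite ?raddf0.
move=> /andP[hom_t hom_ts] [sz_u]; case: x.
  rewrite shifted_partN addnA IHts //; congr (- _).
  by apply: eq_koszul_d => // v _; rewrite addnA.
rewrite shifted_partD add0n IHts // (shifted_partM _ _ _ hom_t).
by rewrite -!addnA [(weight ks u + k)%N]addnC.
Qed.

(** By [acyclic_divisible] every class in the positive-degree homology of [ts] is [t] times another
    one. As [t] has positive degree, induction on the total degree shows that each homogeneous
    component bounds. *)
Lemma acyclic_tail J k ks t ts : is_ideal J -> homogeneous J ->
    (0 < k)%N -> t \is k.-homog -> homog_seq ks ts ->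
  acyclic_mod J (t :: ts) -> acyclic_mod J ts.
Proof.
move=> idJ homJ k_gt0 hom_t hom_ts acyc.
pose part e c u := shifted_part e (weight ks u) (c u).
have partd e c u : size u = size ts ->
    part e (koszul_d ts c) u = koszul_d ts (part e c) u.
  by move=> sz_u; rewrite /part -(koszul_shifted_part e 0).
have bpart e c : c (nseq (size ts) false) = 0 ->
    (forall u, size u = size ts -> J (koszul_d ts c u)) ->
    boundary_mod J ts (part e c).
  elim/ltn_ind: e c => e IHe c c0 cyc.
  have [b0 [b1 [cE b1_0 cyc1]]] := acyclic_divisible idJ acyc c0 cyc.
  have partE u : size u = size ts -> J (part e c u -
      (koszul_d ts (part e b0) u + t * shifted_part e (weight ks u + k) (b1 u))).
    move=> sz_u; rewrite -partd // -(shifted_partM _ _ _ hom_t) -shifted_partD.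
    by rewrite -shifted_partN -shifted_partD; apply: shifted_part_ideal; auto.
  (* For [e < k] the term with factor [t] has no component of total degree [e]. Otherwise that
     component comes from degree [e - k] of [b1], where induction applies. *)
  have [le_ke|lt_ek] := leqP k e; last first.
    exists (part e b0) => u /partE; rewrite /shifted_part ifF ?mulr0 ?addr0 //.
    by apply/negbTE; rewrite -ltnNge (leq_trans lt_ek) ?leq_addl.
  have [|b2 b2P] := IHe (e - k)%N _ b1 b1_0 cyc1; first by lia.
  exists (fun v => part e b0 v + t * b2 v) => u sz_u.
  rewrite koszul_dD koszul_dZ; have := idealD idJ (partE u sz_u)
    (ideal_mull t idJ (b2P u sz_u)); congr J.
  suff ->: shifted_part e (weight ks u + k) (b1 u) = part (e - k)%N b1 u by ring.
  by rewrite /part /shifted_part leq_subRL // [(k + _)%N]addnC addnC subnDA.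
move=> c c0 cyc.
pose h u := (weight ks u + mmeasure mdeg (c u))%N.
(* [mmeasure] exceeds every degree that occurs, so the components of total degree below [E] already
   sum to [c]. *)
have [E leE] : exists E, forall u, size u = size ts -> (h u <= E)%N.
  move: h; elim: (size ts) => [|m IHm] h.
    by exists (h [::]) => -[].
  have [E1 leE1] := IHm (fun u => h (true :: u)).
  have [E0 leE0] := IHm (fun u => h (false :: u)).
  exists (maxn E1 E0) => -[|[] u] //= [sz_u]; rewrite leq_max ?leE1 ?leE0 ?orbT //.
have sumE u : size u = size ts -> c u = \sum_(e < E) part e c u.
  move=> /leE; rewrite /h; set p := c u; set w := weight ks u => le_pE.
  rewrite -(big_mkord predT (fun e => part e c u)) (big_cat_nat (n := w)) //=; last first.
    exact: leq_trans (leq_addr _ _) le_pE.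
  rewrite big_nat_cond big1 ?add0r; last first.
    by move=> e /andP[/andP[_ lt_ew] _]; rewrite /part /shifted_part leqNgt lt_ew.
  rewrite -{1}[w]add0n big_addn big_mkord {1}(@pihomog_partitionE _ _ mdeg (E - w) p).
    by apply: eq_bigr => e _; rewrite /part /shifted_part leq_addl addnK.
  by rewrite leq_subRL // (leq_trans (leq_addr _ _) le_pE).
suff [b bP] : boundary_mod J ts (fun u => \sum_(e < E) part e c u).
  by exists b => u sz_u; rewrite sumE //; apply: bP.
elim: E {leE sumE} => [|E [b bP]].
  by exists (fun=> 0) => u _; rewrite big_ord0 koszul_d0 subrr; apply: ideal0.
have [b' b'P] := bpart E c c0 cyc.
exists (fun u => b u + b' u) => u sz_u; rewrite big_ord_recr koszul_dD /=.
by rewrite opprD addrACA; apply: idealD; auto.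
Qed.

(* A regular sequence in the radical of [J + (ts)] at least as long as [ts]
   forces the homogeneous sequence [ts] to be regular in every order.         *)
Lemma homogeneous_nzd J fs ks ts1 t ts2 x :
    is_ideal J -> homogeneous J ->
    homog_seq ks (ts1 ++ t :: ts2) -> all (leq 1) ks ->
    regular_seq J fs -> (size (ts1 ++ t :: ts2) <= size fs)%N ->
    (forall f, f \in fs -> exists n, add_gens J (ts1 ++ t :: ts2) (f ^+ n)) ->
  add_gens J ts2 (t * x) -> add_gens J ts2 x.
Proof.
move=> idJ homJ hom_ts pos_ks reg le_sz pow.
(* At [i := 1] the length bound of [koszul_vanish] says that [fs] is at least as long as the whole
   sequence. The entries of [ts1] are then removed from the front by [acyclic_tail]. *)
have: acyclic_mod J (ts1 ++ t :: ts2).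
  move=> c c0 cyc; apply: (koszul_vanish (i := 1) idJ reg pow) => // u sz_u.
  by rewrite ltnS leqn0 => /count_id_eq0 ->; rewrite sz_u.
elim: ts1 ks hom_ts pos_ks {le_sz pow} => [|s ts1 IH] [|k ks] //=.
  by move=> _ _; apply: acyclic_nzd.
move=> /andP[hom_s hom_ts] /andP[k_gt0 pos_ks] acyc.
exact: (IH ks hom_ts pos_ks (acyclic_tail idJ homJ k_gt0 hom_s hom_ts acyc)).
Qed.

End GradedNakayama.

(** * Stanley-Reisner ideals *)

Section Monomials.
Variables (K : fieldType) (V : finType).
Local Notation R := {mpoly K[#|V|]}.
Implicit Types (D : {set {set V}}) (F : {set V}) (p q : R) (m : 'X_{1..#|V|}).

Definition mnm_support m : {set V} := [set v | m (enum_rank v) != 0%N].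

Lemma face_monomialE F :
  face_monomial K F = 'X_[[multinom (enum_val i \in F : nat) | i < #|V|]].
Proof.
rewrite mpolyXE_id /face_monomial big_mkcond /= (reindex (@enum_val V V)) /=; last first.
  by apply: onW_bij; apply: enum_val_bij.
apply: eq_bigr => i _; rewrite mnmE enum_valK.
by case: ifP; rewrite ?expr1 ?expr0.
Qed.

Lemma ideal_mpolyX (I : R -> Prop) F m : is_ideal I ->
  I (face_monomial K F) -> F \subset mnm_support m -> I 'X_[m].
Proof.
move=> idI; rewrite face_monomialE => IF /subsetP sFm.
rewrite -(@submK _ [multinom (enum_val i \in F : nat) | i < #|V|]%MM m).
  by rewrite mpolyXD; apply: ideal_mull.
apply/mnm_lepP => i; rewrite mnmE; case: (boolP (_ \in F)) => // /sFm.
by rewrite inE enum_valK; case: (m i).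
Qed.

(** Membership test for the Stanley-Reisner ideal, which, being generated by monomials, contains a
    polynomial exactly when it contains each of its terms. *)
Definition nonface_support D p := forall m, m \in msupp p -> mnm_support m \notin D.

Lemma nonface_support_sr D p : nonface_support D p -> stanley_reisner_ideal D p.
Proof.
have idI := ideal_gen_ideal (fun p => exists2 F, F \notin D & p = face_monomial K F).
move=> nf; rewrite (mpolyE p) big_seq; apply: ideal_sum => // m /nf nfm.
rewrite -mul_mpolyC; apply: ideal_mull => //.
apply: (@ideal_mpolyX _ (mnm_support m)) => //.
by apply: ideal_gen_mem; exists (mnm_support m).
Qed.

Lemma sr_nonface_support D p : simplicial_complex D ->
  stanley_reisner_ideal D p -> nonface_support D p.
Proof.
move=> [_ downD]; apply: ideal_gen_min.
  split.
  - by move=> m; rewrite msupp0.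
  - by move=> x y nx ny m /msuppD_le; rewrite mem_cat => /orP[/nx|/ny].
  - move=> a x nx m /msuppM_le/allpairsP[[m1 m2] /= [_ /nx nm2 ->]].
    apply: contra nm2 => /downD; apply; apply/subsetP => v.
    by rewrite !inE mnmDE addn_eq0 negb_and => ->; rewrite orbT.
move=> y [F nF ->] m; rewrite face_monomialE msuppX inE => /eqP->.
apply: contra nF; suff -> : mnm_support [multinom (enum_val i \in F : nat) | i < #|V|] = F by [].
by apply/setP => v; rewrite inE mnmE enum_rankK; case: (_ \in F).
Qed.

Lemma sr_homogeneous D : simplicial_complex D ->
  homogeneous (@stanley_reisner_ideal K V D).
Proof.
move=> cD e p /(sr_nonface_support cD) nf; apply: nonface_support_sr => m m_supp.
apply: nf; move: m_supp; rewrite !mcoeff_msupp pihomogE raddf_sum /=.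
apply: contraNneq => pm0; rewrite big1 // => m' _; rewrite mcoeffZ mcoeffX.
by case: eqP => [->|]; rewrite ?pm0 ?mul0r ?mulr0.
Qed.

Lemma sr_ideal D : is_ideal (@stanley_reisner_ideal K V D).
Proof. exact: ideal_gen_ideal. Qed.

Lemma irrelevant_is_ideal : is_ideal (@irrelevant_ideal K V).
Proof. exact: ideal_gen_ideal. Qed.

Lemma irrelevant_const p : irrelevant_ideal p -> p@_0%MM = 0.
Proof.
apply: (@ideal_gen_min _ _ (fun p : R => p@_0%MM = 0)).
  have rm0 : forall p q : R, (p * q)@_0%MM = p@_0%MM * q@_0%MM.
    by move=> x y; rewrite -[RHS]/((mcoeff 0%MM x) * (mcoeff 0%MM y)) -rmorphM.
  split=> [|x y x0 y0|a x x0]; first by rewrite mcoeff0.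
    by rewrite mcoeffD x0 y0 addr0.
  by rewrite rm0 x0 mulr0.
move=> y [i ->]; rewrite mcoeffX; case: eqP => // /mnmP/(_ i).
by rewrite mnm0E mnm1E eqxx.
Qed.

Lemma sr_irrelevant D p : set0 \in D -> stanley_reisner_ideal D p -> irrelevant_ideal p.
Proof.
move=> D0; apply: ideal_gen_min => [|y [F nF ->]]; first exact: irrelevant_is_ideal.
have /set0Pn[v Fv] : F != set0 by apply: contraNneq nF => ->.
rewrite /face_monomial (bigD1 v) //=.
apply: (ideal_mulr _ irrelevant_is_ideal).
by apply: ideal_gen_mem; exists (enum_rank v).
Qed.

End Monomials.

(** * Upper bounds for dimension and depth *)

Section Independence.
Variables (K : fieldType) (n : nat).
Local Notation R := {mpoly K[n]}.
Implicit Types (gs : seq R) (e : seq nat).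

Fixpoint box (N d : nat) : seq (seq nat) :=
  if d is d'.+1 then [seq k :: e | k <- iota 0 N, e <- box N d'] else [:: [::]].

Fixpoint power_product gs e : R :=
  match gs, e with
  | g :: gs', k :: e' => g ^+ k * power_product gs' e'
  | _, _ => 1
  end.

Lemma size_box N d : size (box N d) = (N ^ d)%N.
Proof. by elim: d => //= d IHd; rewrite size_allpairs size_iota IHd expnS. Qed.

Lemma uniq_box N d : uniq (box N d).
Proof.
elim: d => //= d IHd; apply: allpairs_uniq; rewrite ?iota_uniq //.
by move=> [k e] [k' e'] _ _ [-> ->].
Qed.

(* If [gs] were algebraically dependent modulo [J 0], divide the relation by
   the largest power of the first element that divides it and reduce modulo
   [J 1], which contains that element.                                        *)
Lemma chain_independent N gs (J : nat -> R -> Prop) (u : seq nat -> K) :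
    (forall i, (i <= size gs)%N -> is_ideal (J i)) ->
    (forall i, (i < size gs)%N ->
       [/\ forall x, J i x -> J i.+1 x, J i.+1 gs`_i
         & forall x, J i (gs`_i * x) -> J i x]) ->
    ~ J (size gs) 1 ->
    J 0%N (\sum_(e <- box N (size gs)) (u e)%:MP * power_product gs e) ->
  forall e, e \in box N (size gs) -> u e = 0.
Proof.
elim: gs J u => [|g gs IHgs] J u /= idJ chain nt.
  rewrite big_seq1 mulr1 => Ju e; rewrite inE => /eqP->.
  apply/eqP/negPn/negP => ue0; apply: nt.
  have := ideal_mull (u [::])^-1%:MP (idJ 0%N isT) Ju.
  by rewrite -mpolyCM mulVf.
rewrite big_allpairs_dep => J0.
pose S k := \sum_(e <- box N (size gs)) (u (k :: e))%:MP * power_product gs e.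
have idJ0 := idJ 0%N isT; have idJ1 := idJ 1%N isT.
have [J01 J1g nzd] := chain 0%N isT.
have {}J0 : J 0%N (\sum_(0 <= k < N) g ^+ k * S k).
  move: J0; rewrite /index_iota subn0; congr J; apply: eq_bigr => k _.
  rewrite mulr_sumr; apply: eq_bigr => e _ /=.
  by rewrite mulrCA.
have nzdX j x : J 0%N (g ^+ j * x) -> J 0%N x.
  elim: j => [|j IHj]; first by rewrite expr0 mul1r.
  by rewrite exprS -mulrA => /nzd /IHj.
have main k : (k < N)%N -> forall e, e \in box N (size gs) -> u (k :: e) = 0.
  (* Once the lower [S j] vanish, [g ^+ k] can be cancelled, which leaves [S k] plus a multiple of
     [g], that is, [S k] modulo [J 1]. *)
  elim/ltn_ind: k => k IHk lt_kN.
  apply: (IHgs (fun i => J i.+1) (fun e => u (k :: e))) => // [i|i|].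
  - exact: (idJ i.+1).
  - exact: (chain i.+1).
  rewrite -/(S k).
  move: J0; rewrite (big_cat_nat (n := k)) ?(ltnW lt_kN) //=.
  rewrite big_nat_cond big1 ?add0r; last first.
    move=> j /andP[/andP[_ lt_jk] _]; rewrite /S big_seq big1 ?mulr0 // => e box_e.
    by rewrite (IHk j) ?mul0r // (ltn_trans lt_jk).
  rewrite big_ltn //.
  have -> : \sum_(k.+1 <= i < N) g ^+ i * S i =
            g ^+ k * (g * \sum_(k.+1 <= i < N) g ^+ (i - k.+1) * S i).
    rewrite mulrA -exprSr mulr_sumr !big_nat; apply: eq_bigr => i /andP[lt_ki _].
    by rewrite mulrA -exprD subnKC.
  rewrite -mulrDr => Jk.
  have {}Jk : J 0%N (S k + g * \sum_(k.+1 <= i < N) g ^+ (i - k.+1) * S i).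
    by apply: nzdX Jk.
  have := idealB idJ1 (J01 _ Jk) (ideal_mulr (\sum_(k.+1 <= i < N) g ^+ (i - k.+1) * S i) idJ1 J1g).
  by rewrite addrK.
move=> e /allpairsP[[k f] /= [k_N box_f ->]]; apply: main => //.
by move: k_N; rewrite mem_iota.
Qed.

Definition degree_le p b := forall m, m \in msupp (p : R) -> (mdeg m <= b)%N.

Lemma degree_leM p q a b : degree_le p a -> degree_le q b -> degree_le (p * q) (a + b).
Proof.
move=> dp dq m /msuppM_le/allpairsP[[m1 m2] /= [/dp d1 /dq d2 ->]].
by rewrite mdegD leq_add.
Qed.

Lemma degree_leW p a b : (a <= b)%N -> degree_le p a -> degree_le p b.
Proof. by move=> le_ab dp m /dp /leq_trans; apply. Qed.

Lemma degree_leC c b : degree_le c%:MP b.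
Proof.
by move=> m; rewrite msuppC; case: ifP => // _; rewrite inE => /eqP->; rewrite mdeg0.
Qed.

Lemma degree_le_sum (r : seq (seq nat)) (F : seq nat -> R) b :
  (forall e, e \in r -> degree_le (F e) b) -> degree_le (\sum_(e <- r) F e) b.
Proof.
move=> dF; rewrite big_seq; elim/big_ind: _ => //.
  by move=> m; rewrite msupp0.
by move=> p q dp dq m /msuppD_le; rewrite mem_cat => /orP[/dp|/dq].
Qed.

Lemma degree_le_power_product gs e N b : (forall g, g \in gs -> degree_le g b) ->
  e \in box N (size gs) -> degree_le (power_product gs e) (size gs * (N * b)).
Proof.
move=> dg; elim: gs e dg => [|g gs IHgs] e dg /=; first by move=> _; apply: degree_leC.
case/allpairsP=> -[k f] /= [k_N box_f ->] /=; rewrite mulSn; apply: degree_leM.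
  have dgg : degree_le g b by apply: dg; rewrite inE eqxx.
  move: k_N; rewrite mem_iota /= add0n => lt_kN.
  apply: (@degree_leW _ (k * b)); first by rewrite leq_mul2r ltnW ?orbT.
  elim: k {lt_kN} => [|k IHk]; first exact: degree_leC.
  by rewrite exprS mulSn; apply: degree_leM.
by apply: IHgs => // g' gs_g'; apply: dg; rewrite inE gs_g' orbT.
Qed.

Lemma degree_le_seq gs : exists b, forall g, g \in gs -> degree_le g b.
Proof.
exists (\max_(g <- gs) msize g) => g gs_g m /msize_mdeg_lt /ltnW /leq_trans; apply.
by rewrite (big_rem g) //= leq_maxl.
Qed.

End Independence.

Section Dimension.
Variables (K : fieldType) (V : finType).
Local Notation R := {mpoly K[#|V|]}.
Implicit Types (D : {set {set V}}) (F : {set V}) (p q : R) (m : 'X_{1..#|V|}).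

(** A monomial is recorded by its support and its exponents there, listed in [d] slots. What matters
    is that the bound grows like the power [d] of the degree. *)
Lemma count_monomials D d b : (forall F, F \in D -> (#|F| <= d)%N) ->
  exists (T : finType) (f : T -> 'X_{1..#|V|}), #|T| = (2 ^ #|V| * b.+1 ^ d)%N /\
    forall m, mnm_support m \in D -> (mdeg m <= b)%N -> exists t, f t = m.
Proof.
move=> leD; pose T : finType := ({set V} * {ffun 'I_d -> 'I_b.+1})%type.
pose f (t : T) := [multinom (if enum_val i \in t.1 then
   oapp (fun j => val (t.2 j)) 0%N (insub (index (enum_val i) (enum t.1)))
   else 0%N) | i < #|V|].
exists T, f; split.
  by rewrite card_prod card_ffun !card_ord -cardsT -powersetT card_powerset cardsT.
move=> m Dm deg_m; pose F := mnm_support m.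
exists (F, [ffun j : 'I_d => inord (nth 0%N [seq m (enum_rank v) | v <- enum F] j)]).
apply/mnmP => i; rewrite mnmE /=; case: ifP => [Fi|]; last first.
  by rewrite inE enum_valK; case: (m i).
have lt_i : (index (enum_val i) (enum F) < size (enum F))%N by rewrite index_mem mem_enum.
have lt_id : (index (enum_val i) (enum F) < d)%N.
  by apply: leq_trans lt_i _; rewrite -cardE leD.
rewrite insubT /= ffunE /= (nth_map (enum_val i)) // nth_index ?mem_enum //.
rewrite enum_valK inordK // ltnS; apply: leq_trans deg_m.
by rewrite mdegE (bigD1 i) //= leq_addr.
Qed.

Lemma wide_kernel a b (A : 'M[K]_(a, b)) : (b < a)%N ->
  exists2 u : 'rV[K]_a, u != 0 & u *m A = 0.
Proof.
move=> lt_ba; have /rowV0Pn[u] : kermx A != 0.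
  by rewrite -mxrank_eq0 mxrank_ker subn_eq0 -ltnNge (leq_ltn_trans (rank_leq_col A)).
by move=> /sub_kermxP uA u0; exists u.
Qed.

(** More than [d] polynomials have more power products than there are monomials with face support in
    the degrees reached, so linear algebra yields a relation. *)
Lemma faces_dependent D d (gs : seq R) : (forall F, F \in D -> (#|F| <= d)%N) ->
  (d < size gs)%N ->
  exists N u, (exists2 e, e \in box N (size gs) & u e != 0) /\
    stanley_reisner_ideal D (\sum_(e <- box N (size gs)) (u e)%:MP * power_product gs e).
Proof.
move=> leD lt_d; have [b leb] := degree_le_seq gs.
(* The degrees of the power products stay below [N * C], and [N] exceeds [2 ^ #|V| * C ^ d]. So the
   power products, at least [N ^ d.+1] of them, outnumber [2 ^ #|V| * (N * C) ^ d]. *)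
pose C := (size gs * b).+1; pose N := (2 ^ #|V| * C ^ d).+1.
have [T [f [cardT fP]]] := count_monomials (size gs * (N * b)) leD.
pose bx := box N (size gs).
have lt_T : (#|T| < size bx)%N.
  rewrite cardT size_box.
  have le_N : (2 ^ #|V| * (size gs * (N * b)).+1 ^ d <= 2 ^ #|V| * (N * C) ^ d)%N.
    rewrite leq_mul2l; apply/orP; right; have: ((size gs * (N * b)).+1 <= N * C)%N.
      by rewrite /C mulnS mulnCA addnC -addn1 leq_add2l.
    by case: (d) => // k; rewrite leq_exp2r.
  apply: leq_ltn_trans le_N _; rewrite expnMn mulnCA mulnC.
  apply: (@leq_trans (N ^ d.+1)); last by rewrite leq_pexp2l.
  by rewrite expnS ltn_mul2r expn_gt0 /= ltnSn.
pose M := \matrix_(i < size bx, t < #|T|) (power_product gs (nth [::] bx i))@_(f (enum_val t)).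
have [w w0 wM] := wide_kernel M lt_T.
exists N, (fun e => oapp (w 0) 0 (insub (index e bx))); split.
  have [i wi] : exists i, w 0 i != 0.
    apply/existsP; apply: contraNT w0 => /existsPn w0; apply/eqP/rowP => i.
    by rewrite mxE; apply/eqP/negbNE/w0.
  exists (nth [::] bx i); first by rewrite mem_nth.
  by rewrite index_uniq ?uniq_box // valK.
apply: nonface_support_sr => m m_supp; apply: contraTN m_supp => Dm.
set p := \sum_(e <- _) _.
have [|/(fP _ Dm)[t <-]] := ltnP (size gs * (N * b)) (mdeg m).
  rewrite ltnNge; apply: contra; apply: degree_le_sum => e bx_e.
  by apply: (@degree_leM _ _ _ _ 0) (degree_le_power_product leb bx_e); apply: degree_leC.
have : (w *m M) 0 (enum_rank t) = 0 by rewrite wM mxE.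
rewrite -mcoeff_eq0 => w0t; apply/eqP; rewrite -[RHS]w0t /p (big_nth [::]) big_mkord.
rewrite raddf_sum mxE; apply: eq_bigr => i _.
by rewrite /= mul_mpolyC mcoeffZ index_uniq ?uniq_box // valK mxE enum_rankK.
Qed.

(** Bounds dimension and depth at once: a chain of primes, with one element picked at each step, and
    a regular sequence both satisfy these hypotheses. *)
Lemma chain_length D d (gs : seq R) (J : nat -> R -> Prop) :
    (forall F, F \in D -> (#|F| <= d)%N) ->
    (forall i, (i <= size gs)%N -> is_ideal (J i)) ->
    (forall i, (i < size gs)%N ->
       [/\ forall x, J i x -> J i.+1 x, J i.+1 gs`_i
         & forall x, J i (gs`_i * x) -> J i x]) ->
    ~ J (size gs) 1 ->
    (forall x, stanley_reisner_ideal D x -> J 0%N x) ->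
  (size gs <= d)%N.
Proof.
move=> leD idJ chain nt IJ; rewrite leqNgt; apply/negP => lt_d.
have [N [u [[e bx_e /eqP ue] /IJ Ju]]] := faces_dependent leD lt_d.
exact: ue (chain_independent idJ chain nt Ju bx_e).
Qed.

Lemma prime_chain_le D d n : (forall F, F \in D -> (#|F| <= d)%N) ->
  has_prime_chain (@stanley_reisner_ideal K V D) n -> (n <= d)%N.
Proof.
move=> leD [p [primes chain]].
have [i /chain[_ [x px npx]]|gs [sz_gs gsP]] :=
  @seq_choice _ (fun i x => p i.+1 x /\ ~ p i x) (0 : R) n; first by exists x.
rewrite -sz_gs; apply: (chain_length (J := p) leD); rewrite ?sz_gs.
- by move=> i /primes[[]].
- move=> i lt_in; have [pi npi] := gsP i lt_in; have [pS _] := chain i lt_in.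
  split=> // x; have [[_ _ prime] _] := primes i (ltnW lt_in).
  by move=> /prime[].
- by have [[]] := primes n (leqnn n).
- by have [] := primes 0%N (leq0n n).
Qed.

Lemma regular_seq_le D d s : (forall F, F \in D -> (#|F| <= d)%N) ->
  regular_seq (@stanley_reisner_ideal K V D) s -> (size s <= d)%N.
Proof.
move=> leD [reg nt].
apply: (chain_length (J := fun i => add_gens (stanley_reisner_ideal D) (take i s)) leD).
- by move=> i _; apply: add_gens_ideal.
- move=> i lt_is; split; last exact: reg.
    move=> x; apply: (add_gens_min (add_gens_ideal _ _)) => y; first exact: add_gens_sub.
    by move=> ys; apply: add_gens_mem; rewrite (take_nth 0) // mem_rcons inE ys orbT.
  by apply: add_gens_mem; rewrite (take_nth 0) // mem_rcons inE eqxx.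
- by rewrite take_size.
- by move=> x Ix; rewrite take0; apply: add_gens_sub.
Qed.

End Dimension.

(** * Substitutions and prime chains *)

Section MpolyMorphisms.
Variables (K : fieldType).

Lemma mpoly_ring_ind n (P : {mpoly K[n]} -> Prop) :
    (forall c, P c%:MP) -> (forall i, P 'X_i) ->
    (forall p q, P p -> P q -> P (p + q)) -> (forall p q, P p -> P q -> P (p * q)) ->
  forall p, P p.
Proof.
move=> PC PX PD PM; apply: mpolyind => [|c m p _ _ Pp]; first by rewrite -mpolyC0.
apply: PD => //; rewrite -mul_mpolyC; apply: (PM) => //; rewrite mpolyXE_id.
elim/big_ind: _ => [||i _]; [by rewrite -mpolyC1|exact: PM|].
by elim: (m i) => [|k IHk]; rewrite ?expr0 -?mpolyC1 // exprS; apply: (PM).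
Qed.

Variables (V W : finType).

Lemma subst_vars_subproof (f : V -> {mpoly K[#|W|]}) :
  {s : {rmorphism {mpoly K[#|V|]} -> {mpoly K[#|W|]}} |
    (forall c, s c%:MP = c%:MP) /\ forall v, s 'X_(enum_rank v) = f v}.
Proof.
exists (mmap (@mpolyC #|W| K) (f \o enum_val)); split=> [c|v] /=.
  exact: mmapC.
by rewrite mmapX mmap1U /= enum_rankK.
Qed.

Definition subst_vars f := sval (subst_vars_subproof f).

Lemma subst_varsC f c : subst_vars f c%:MP = c%:MP.
Proof. by rewrite /subst_vars; case: subst_vars_subproof => s []. Qed.

Lemma subst_varsX f v : subst_vars f 'X_(enum_rank v) = f v.
Proof. by rewrite /subst_vars; case: subst_vars_subproof => s []. Qed.

Lemma subst_vars_face f (F : {set V}) :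
  subst_vars f (face_monomial K F) = \prod_(v in F) f v.
Proof.
by rewrite /face_monomial rmorph_prod; apply: eq_bigr => v _; apply: subst_varsX.
Qed.

End MpolyMorphisms.

(** The primes are the kernels of the maps that set to zero all variables outside a shrinking set
    [G i] of vertices of [F]. They are prime since the target is a domain, and contain the
    Stanley-Reisner ideal since no nonface lies inside [F]. *)
Lemma sr_prime_chain (K : fieldType) (V : finType) (D : {set {set V}}) F :
  simplicial_complex D -> F \in D ->
  has_prime_chain (@stanley_reisner_ideal K V D) #|F|.
Proof.
move=> [_ downD] DF.
pose G i := [set v in drop i (enum F)].
pose f i v : {mpoly K[#|V|]} := if v \in G i then 'X_(enum_rank v) else 0.
pose s i := subst_vars (f i).
have sub_G i : {subset G i.+1 <= G i}.
  by move=> v; rewrite !inE -addn1 addnC -drop_drop => /mem_drop.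
exists (fun i p => s i p = 0); split=> i lt_i.
  have idp : is_ideal (fun p => s i p = 0).
    split=> [|x y sx sy|a x sx]; first exact: rmorph0.
      by rewrite rmorphD sx sy addr0.
    by rewrite rmorphM sx mulr0.
  split; first split=> //.
  - by rewrite rmorph1; apply/eqP; rewrite oner_eq0.
  - by move=> x y /eqP; rewrite rmorphM mulf_eq0 => /orP[]/eqP; [left|right].
  move=> x; apply: (ideal_gen_min idp) => y [H nH ->].
  have /subsetPn[v Hv nGv] : ~~ (H \subset G i).
    apply: contra nH => /subset_trans sub; apply: downD DF (sub _ _).
    by apply/subsetP => v; rewrite inE => /mem_drop; rewrite mem_enum.
  by rewrite /s subst_vars_face (bigD1 v) //= /f (negbTE nGv) mul0r.
split.
  (* Setting more variables to zero factors through setting fewer, so the kernels increase. *)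
  have comp p : s i.+1 (s i p) = s i.+1 p.
    elim/mpoly_ring_ind: p => [c|j|p q sp sq|p q sp sq].
    - by rewrite /s !subst_varsC.
    - rewrite -(enum_valK j); move: (enum_val j) => v; rewrite /s !subst_varsX.
      have [Gv|nGv] := boolP (v \in G i).
        have -> : f i v = 'X_(enum_rank v) by rewrite /f Gv.
        exact: subst_varsX.
      have nGv' : v \notin G i.+1 by apply: contra nGv => /sub_G.
      have f0 k : v \notin G k -> f k v = 0 by rewrite /f => /negbTE->.
      by rewrite !f0 // rmorph0.
    - by rewrite !rmorphD sp sq.
    - by rewrite !rmorphM sp sq.
  by move=> x sx; rewrite -comp sx rmorph0.
have [v0 _] : exists v, v \in F by apply/card_gt0P; apply: leq_ltn_trans (leq0n _) lt_i.
have sz_i : (i < size (enum F))%N by rewrite -cardE.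
have drop_i := drop_nth v0 sz_i.
(* The variable of the vertex that leaves [G i] makes the inclusion strict. *)
exists 'X_(enum_rank (nth v0 (enum F) i)); rewrite /s subst_varsX /f.
  rewrite ifF // inE; apply/negbTE.
  by have := drop_uniq i (enum_uniq F); rewrite drop_i /= => /andP[].
rewrite inE drop_i inE eqxx /=; set j := enum_rank _ => /(congr1 (mcoeff U_(j)%MM)).
by rewrite mcoeffX eqxx mcoeff0 => /eqP; rewrite oner_eq0.
Qed.

(** * Systems of parameters *)

Section ElementarySymmetric.
Variables (A : comNzRingType) (I : finType).
Implicit Types (x : I -> A) (S : {set I}).

(** For [i <= #|S|] this is [(-1) ^+ i] times the elementary symmetric polynomial of degree [i] in
    the [x v]. *)
Definition esym x S i : A := (\prod_(v in S) ('X - (x v)%:P))`_(#|S| - i).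

Lemma esymE x S i : (i <= #|S|)%N -> esym x S i =
  (-1) ^+ i * \sum_(B : {set I} | (B \subset S) && (#|B| == i)) \prod_(v in B) x v.
Proof.
move=> le_iS; rewrite /esym.
have -> : \prod_(v in S) ('X - (x v)%:P) = \prod_v
    ((if v \in S then - (x v)%:P else 0) + (if v \in S then 'X else 1)).
  by rewrite big_mkcond; apply: eq_bigr => v _; case: ifP; rewrite ?add0r // addrC.
rewrite bigA_distr coef_sum mulr_sumr [RHS]big_mkcond; apply: eq_bigr => B _.
have [sBS|nsBS] /= := boolP (B \subset S); last first.
  have /subsetPn[v Bv nSv] := nsBS.
  by rewrite (bigD1 v) //= Bv (negbTE nSv) mul0r coef0.
have -> : \prod_v (if v \in B then if v \in S then - (x v)%:P else 0
                   else if v \in S then 'X else 1) =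
          ((-1) ^+ #|B| * \prod_(v in B) x v)%:P * 'X^(#|S| - #|B|).
  rewrite (bigID (mem B)) /=; congr (_ * _).
    rewrite rmorphM rmorphXn rmorphN1 rmorph_prod -prodrN /=.
    by apply: eq_bigr => v Bv; rewrite Bv (subsetP sBS).
  have -> : (#|S| - #|B|)%N = #|S :\: B| by rewrite cardsD (setIidPr sBS).
  rewrite -prodr_const (eq_bigr (fun v => if v \in S then 'X else 1)).
    by rewrite -big_mkcondr; apply: eq_bigl => v; rewrite in_setD.
  by move=> v /negbTE->.
rewrite coefCM coefXn; have le_BS := subset_leq_card sBS.
case: (eqVneq #|B| i) => [<-|ne_Bi]; first by rewrite eqxx mulr1.
rewrite [_ == _](_ : _ = false) ?mulr0 //; apply/eqP; move/eqP: ne_Bi; lia.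
Qed.

Lemma esym_ideal (J : A -> Prop) x S i : is_ideal J -> (i <= #|S|)%N ->
    (forall B : {set I}, B \subset S -> #|B| = i -> J (\prod_(v in B) x v)) ->
  J (esym x S i).
Proof.
move=> idJ le_iS JB; rewrite esymE //; apply: ideal_mull => //.
by apply: ideal_sum => // B /andP[sBS /eqP cB]; apply: JB.
Qed.

(* [x v] is a root of the polynomial whose coefficients are the [esym x S i] *)
Lemma esym_root (J : A -> Prop) x S v : is_ideal J ->
    (forall i, (0 < i <= #|S|)%N -> J (esym x S i)) ->
  v \in S -> J (x v ^+ #|S|).
Proof.
move=> idJ JS Sv; pose P := \prod_(v in S) ('X - (x v)%:P).
have szP : size P = #|S|.+1.
  by rewrite /P -big_enum size_prod_XsubC -cardE.
have P0 : P.[x v] = 0.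
  by rewrite /P (bigD1 v) //= hornerM hornerXsubC subrr mul0r.
have Plead : P`_#|S| = 1.
  have /monicP := monic_prod_XsubC (enum S) xpredT x.
  by rewrite big_enum /lead_coef -/P szP.
move: P0; rewrite horner_coef szP big_ord_recr /= Plead mul1r => /eqP.
rewrite addrC addr_eq0 => /eqP->; apply: idealN => //; apply: ideal_sum => // i _.
apply: ideal_mulr => //; have lt_i := ltn_ord i.
have := JS (#|S| - i)%N; rewrite /esym subKn ?(ltnW lt_i) //; apply.
by rewrite subn_gt0 lt_i leq_subr.
Qed.

End ElementarySymmetric.

Lemma rmorph_esym (A B : comNzRingType) (I : finType) (f : {rmorphism A -> B})
    (x : I -> A) (S : {set I}) i : (i <= #|S|)%N ->
  f (esym x S i) = esym (f \o x) S i.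
Proof.
move=> le_iS; rewrite !esymE // rmorphM rmorphXn rmorphN1 rmorph_sum; congr (_ * _).
by apply: eq_bigr => B' _; apply: rmorph_prod.
Qed.

Lemma esym_imset (A : comNzRingType) (I I' : finType) (r : I -> I') (x : I' -> A)
    (S : {set I}) i : {in S &, injective r} ->
  esym (x \o r) S i = esym x (r @: S) i.
Proof. by move=> inj_r; rewrite /esym big_imset //= card_in_imset. Qed.

Lemma esym_homog (K : fieldType) (V : finType) (S : {set V}) i :
  (i <= #|S|)%N ->
  esym (fun v => 'X_(enum_rank v) : {mpoly K[#|V|]}) S i \is i.-homog.
Proof.
move=> le_iS; rewrite esymE //.
have hom_sign : ((-1) ^+ i : {mpoly K[#|V|]}) \is (0%N).-homog.
  by rewrite -signr_odd; case: odd; rewrite ?expr0 ?expr1 ?rpredN dhomog1.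
rewrite -[X in X.-homog]add0n; apply: dhomogM => //.
apply: rpred_sum => B /andP[_ /eqP <-].
rewrite -[\prod_(v in B) _]/(face_monomial K B) face_monomialE dhomogX /= mdegE.
rewrite (reindex (@enum_rank V)) /=; last by apply: onW_bij; apply: enum_rank_bij.
apply/eqP; rewrite -[RHS]sum1_card [RHS]big_mkcond; apply: eq_bigr => v _.
by rewrite mnmE enum_rankK; case: (v \in B).
Qed.

Lemma esym_irrelevant (K : fieldType) (V : finType) (S : {set V}) i :
  (0 < i <= #|S|)%N ->
  irrelevant_ideal (esym (fun v => 'X_(enum_rank v) : {mpoly K[#|V|]}) S i).
Proof.
move=> /andP[i_gt0 le_iS]; apply: esym_ideal => // [|B _ cB].
  exact: irrelevant_is_ideal.
have /card_gt0P[v Bv] : (0 < #|B|)%N by rewrite cB.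
rewrite (bigD1 v) //=; apply: (ideal_mulr _ (@irrelevant_is_ideal K V)).
by apply: ideal_gen_mem; exists (enum_rank v).
Qed.

(** * Induced subcomplexes as algebra retracts *)

Section InducedSubcomplex.
Variables (K : fieldType) (V W : finType).
Variables (L : {set {set V}}) (L' : {set {set W}}) (r : W -> V) (A : {set W}).
Hypotheses (complexL : simplicial_complex L) (complexL' : simplicial_complex L').
Hypothesis subA : forall Y : {set W}, Y \in L' -> Y \subset A.
Hypothesis inj_r : {in A &, injective r}.
Hypothesis isoL : forall Y : {set W}, Y \subset A -> (Y \in L') = (r @: Y \in L).

Local Notation X v := ('X_(enum_rank v)).
Let B := r @: A.

(** [phi] carries the ring of [L'] into that of [L] along [r], and [psi], which kills the variables
    outside [B], is a retraction. Elements outside [A] are not vertices of [L'], so their variables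
    may go to 0. *)
Definition lift_var y : {mpoly K[#|V|]} := if y \in A then X (r y) else 0.
Definition proj_var v : {mpoly K[#|W|]} :=
  if [pick y in A | r y == v] is Some y then X y else 0.
Let phi := subst_vars lift_var.
Let psi := subst_vars proj_var.
Let IL := @stanley_reisner_ideal K V L.
Let IL' := @stanley_reisner_ideal K W L'.

Lemma proj_varK y : y \in A -> proj_var (r y) = X y.
Proof.
move=> Ay; rewrite /proj_var; case: pickP => [z /andP[Az /eqP eq_r]|/(_ y)].
  by rewrite (inj_r Az Ay).
by rewrite Ay eqxx.
Qed.

Lemma lift_sr p : IL' p -> IL (phi p).
Proof.
have idI : is_ideal (fun p => IL (phi p)).
  split=> [|x y Ix Iy|a x Ix]; rewrite ?rmorph0 ?rmorphD ?rmorphM.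
  - exact: (ideal0 (@sr_ideal K V L)).
  - exact: (idealD (@sr_ideal K V L)).
  - exact: (ideal_mull _ (@sr_ideal K V L)).
apply: (ideal_gen_min idI) => _ [Y nY ->]; rewrite /phi subst_vars_face.
have [sYA|/subsetPn[y Yy nAy]] := boolP (Y \subset A); last first.
  by rewrite (bigD1 y) //= /lift_var (negbTE nAy) mul0r; apply: (ideal0 (@sr_ideal K V L)).
apply: ideal_gen_mem; exists (r @: Y); first by rewrite -isoL.
rewrite /face_monomial big_imset /=; last first.
  by move=> ? ? /(subsetP sYA) ? /(subsetP sYA); apply: inj_r.
by apply: eq_bigr => y Yy; rewrite /lift_var (subsetP sYA).
Qed.

Lemma proj_sr p : IL p -> IL' (psi p).
Proof.
have idI : is_ideal (fun p => IL' (psi p)).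
  split=> [|x y Ix Iy|a x Ix]; rewrite ?rmorph0 ?rmorphD ?rmorphM.
  - exact: (ideal0 (@sr_ideal K W L')).
  - exact: (idealD (@sr_ideal K W L')).
  - exact: (ideal_mull _ (@sr_ideal K W L')).
apply: (ideal_gen_min idI) => _ [F nF ->]; rewrite /psi subst_vars_face.
have [sFB|/subsetPn[v Fv nBv]] := boolP (F \subset B); last first.
  rewrite (bigD1 v) //= {1}/proj_var; case: pickP => [y /andP[Ay /eqP ry]|_].
    by move: nBv; rewrite -ry imset_f.
  by rewrite mul0r; apply: (ideal0 (@sr_ideal K W L')).
pose Y := [set y in A | r y \in F].
have sYA : Y \subset A by apply/subsetP => y; rewrite inE => /andP[].
have rY : r @: Y = F.
  apply/setP => v; apply/imsetP/idP => [[y]|Fv]; first by rewrite inE => /andP[_ +] ->.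
  have /imsetP[y Ay ry] := subsetP sFB v Fv.
  by exists y => //; rewrite inE Ay -ry.
apply: ideal_gen_mem; exists Y; first by rewrite isoL // rY.
rewrite -rY big_imset /=; last by move=> ? ? /(subsetP sYA) ? /(subsetP sYA); apply: inj_r.
by apply: eq_bigr => y /(subsetP sYA); apply: proj_varK.
Qed.

(** The composite is the identity only modulo [IL']: variables outside [A] are sent to 0, and they
    lie in [IL'] by [subA]. *)
Lemma proj_liftK p : IL' (psi (phi p) - p).
Proof.
have idI := @sr_ideal K W L'.
elim/mpoly_ring_ind: p => [c|i|p q Ip Iq|p q Ip Iq].
- by rewrite /phi /psi !subst_varsC subrr; apply: ideal0.
- rewrite -(enum_valK i); move: (enum_val i) => y.
  rewrite /phi subst_varsX /lift_var; case: ifP => [Ay|nAy].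
    by rewrite /psi subst_varsX proj_varK // subrr; apply: ideal0.
  rewrite rmorph0 sub0r; apply: idealN => //.
  apply: ideal_gen_mem; exists [set y]; last by rewrite /face_monomial big_set1.
  by apply/negP => /subA; rewrite sub1set nAy.
- by rewrite !rmorphD opprD addrACA; apply: idealD.
- have -> : psi (phi (p * q)) - p * q =
    psi (phi p) * (psi (phi q) - q) + (psi (phi p) - p) * q by rewrite !rmorphM; ring.
  by apply: idealD => //; [apply: ideal_mull|apply: ideal_mulr].
Qed.

Lemma lift_esym i : (i <= #|A|)%N ->
  phi (esym (fun y => X y) A i) = esym (fun v => X v) B i.
Proof.
move=> le_iA.
have -> := @rmorph_esym _ _ _ phi (fun y => X y) A i le_iA.
have <- := @esym_imset _ _ _ r (fun v => X v) A i inj_r.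
do 2![rewrite (esymE _ le_iA)]; congr (_ * _).
apply: eq_bigr => C /andP[/subsetP sCA _]; apply: eq_bigr => y /sCA Ay /=.
by rewrite /phi subst_varsX /lift_var Ay.
Qed.

(** [F] attains at once the maximal numbers [d1] of vertices in [B] and [d2] outside [B]. Thus a
    product of more than [d1] distinct variables of [B], or of more than [d2] others, vanishes in
    the ring of [L], whose dimension is at least [d1 + d2] because of [F]. *)
Lemma cohen_macaulay_induced F :
    F \in L ->
    (forall H, H \in L -> #|H :&: B| <= #|F :&: B| /\ #|H :\: B| <= #|F :\: B|)%N ->
  cohen_macaulay K L -> cohen_macaulay K L'.
Proof.
move=> LF maxF [d [[_ max_d] [[fs [sz_fs fs_m reg_fs]] _]]].
have idIL := @sr_ideal K V L; have idIL' := @sr_ideal K W L'.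
pose d1 := #|F :&: B|; pose d2 := #|F :\: B|.
have le_d : (d1 + d2 <= d)%N by rewrite cardsID; apply: max_d; apply: sr_prime_chain.
have cardB : #|B| = #|A| by apply: card_in_imset.
have le_d1A : (d1 <= #|A|)%N by rewrite -cardB subset_leq_card ?subsetIr.
have le_d1B : (d1 <= #|B|)%N by rewrite cardB.
have le_d2B : (d2 <= #|~: B|)%N by rewrite subset_leq_card // setDE subsetIr.
have leL' Y : Y \in L' -> (#|Y| <= d1)%N.
  move=> L'Y; have sYA := subA L'Y; have LrY : r @: Y \in L by rewrite -isoL.
  have [+ _] := maxF _ LrY; congr (_ <= _)%N.
  rewrite (setIidPl (imsetS r sYA)) card_in_imset //.
  by move=> ? ? /(subsetP sYA) ? /(subsetP sYA); apply: inj_r.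
pose XV v : {mpoly K[#|V|]} := X v; pose XW y : {mpoly K[#|W|]} := X y.
pose t' i := esym XW A i.+1; pose t i := esym XV B i.+1.
pose T' := mkseq t' d1; pose T i := mkseq t i.
have phit' i : (i < d1)%N -> phi (t' i) = t i.
  by move=> lt_i; apply: lift_esym; apply: leq_trans le_d1A.
have nzdT i x : (i < d1)%N -> add_gens IL (T i) (t i * x) -> add_gens IL (T i) x.
  move=> lt_i.
  (* [homogeneous_nzd] keeps what stands after the chosen entry. So the parameter of degree [i.+1]
     in [B] is placed right before those of degrees 1 to [i], and all others come first. *)
  pose s2 := [seq (false, k.+1) | k <- iota 0 d2].
  pose s1 := [seq (true, k.+1) | k <- rev (iota i.+1 (d1 - i.+1))].
  pose s0 := [seq (true, k.+1) | k <- iota 0 i].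
  pose s := (s2 ++ s1) ++ (true, i.+1) :: s0.
  pose th (b : bool * nat) := esym XV (if b.1 then B else ~: B) b.2.
  have th_s0 : map th s0 = T i by rewrite -map_comp.
  have sP b : b \in s -> (0 < b.2 <= #|if b.1 then B else ~: B|)%N.
    rewrite !mem_cat inE => /orP[/orP[]|/orP[/eqP->|]] /=.
    - by move=> /mapP[k]; rewrite mem_iota => /andP[_ lt_k] -> /=; apply: leq_trans le_d2B.
    - move=> /mapP[k]; rewrite mem_rev mem_iota subnKC // => /andP[_ lt_k] -> /=.
      exact: leq_trans le_d1B.
    - exact: leq_trans le_d1B.
    - move=> /mapP[k]; rewrite mem_iota => /andP[_ lt_k] -> /=.
      by apply: leq_trans le_d1B; apply: leq_trans lt_k _; apply: ltnW.
  have mem_s k : (k < d1)%N -> (true, k.+1) \in s.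
    move=> lt_k; rewrite !mem_cat inE; case: (ltngtP k i) => [lt_ki|lt_ik|->].
    - by apply/orP; right; apply/orP; right; apply/map_f; rewrite mem_iota.
    - apply/orP; left; apply/orP; right; apply/map_f.
      by rewrite mem_rev mem_iota lt_ik subnKC.
    - by rewrite eqxx orbT.
  have mem_s2 k : (k < d2)%N -> (false, k.+1) \in s.
    by move=> lt_k; rewrite !mem_cat; do 2![apply/orP; left]; apply/map_f; rewrite mem_iota.
  have sz_s : size s = (d1 + d2)%N.
    by rewrite !size_cat /= !size_map size_rev !size_iota; lia.
  rewrite -th_s0 -[t i]/(th (true, i.+1)).
  have split_s : map th s = map th (s2 ++ s1) ++ th (true, i.+1) :: map th s0.
    by rewrite /s map_cat.
  apply: (homogeneous_nzd (ks := map snd s) (fs := fs) (ts1 := map th (s2 ++ s1)) idIL) => //.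
  - exact: sr_homogeneous.
  - rewrite -split_s; have: {subset s <= s} by [].
    elim: {1 3 4}s => //= b s' IHs sub; rewrite IHs ?andbT; last first.
      by move=> z s'z; apply: sub; rewrite inE s'z orbT.
    apply: esym_homog; have /sP/andP[] // : b \in s by apply: sub; rewrite inE eqxx.
  - by rewrite all_map; apply/allP => b /sP /andP[].
  - by rewrite -split_s size_map sz_s sz_fs.
  - move=> f /fs_m; rewrite -split_s; apply: ideal_gen_exp; first exact: add_gens_ideal.
    move=> _ [j ->]; rewrite -(enum_valK j); move: (enum_val j) => v.
    (* Symmetric polynomials of degree up to [k] belong to the sequence, and those of higher degree
       lie in [IL], being sums of nonface monomials up to sign; hence [esym_root] applies. *)
    have root (b : bool) k : k = (if b then d1 else d2) ->
        (forall l, (l < k)%N -> (b, l.+1) \in s) ->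
        v \in (if b then B else ~: B) -> exists n, add_gens IL (map th s) (XV v ^+ n).
      move=> kE bk_s Bv; exists #|if b then B else ~: B|.
      apply: esym_root Bv; first exact: add_gens_ideal.
      move=> [|l] // /andP[_ le_l]; have [lt_lk|le_kl] := ltnP l k.
        by apply: add_gens_mem; apply/mapP; exists (b, l.+1); rewrite ?bk_s.
      apply: add_gens_sub; apply: esym_ideal => // C sC cC.
      apply: ideal_gen_mem; exists C => //; apply/negP => /maxF [].
      move: sC kE le_kl; rewrite setDE; case: (b) => /setIidPl -> -> le_kl.
        by rewrite cC leqNgt ltnS le_kl.
      by move=> _; rewrite cC leqNgt ltnS le_kl.
    have [Bv|nBv] := boolP (v \in B); first exact: (root true d1 erefl mem_s).
    by apply: (root false d2 erefl mem_s2); rewrite inE.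
(* The relation is lifted by [phi], simplified in the ring of [L], and brought back by [psi], which
   returns [x] modulo [IL']. *)
have nzdT' i x : (i < d1)%N -> add_gens IL' (mkseq t' i) (t' i * x) -> add_gens IL' (mkseq t' i) x.
  move=> lt_i Itx.
  have lift z : add_gens IL' (mkseq t' i) z -> add_gens IL (T i) (phi z).
    have idJ : is_ideal (fun z => add_gens IL (T i) (phi z)).
      have idT := add_gens_ideal IL (T i).
      split=> [|y y' Iy Iy'|a y Iy]; rewrite ?rmorph0 ?rmorphD ?rmorphM.
      - exact: ideal0.
      - exact: idealD.
      - exact: ideal_mull.
    apply: (add_gens_min idJ) => y; first by move=> /lift_sr; apply: add_gens_sub.
    move=> /mapP[k]; rewrite mem_iota add0n => /andP[_ lt_k] ->.
    by rewrite phit' ?(ltn_trans lt_k) //; apply: add_gens_mem; apply/map_f; rewrite mem_iota.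
  have proj z : add_gens IL (T i) z -> add_gens IL' (mkseq t' i) (psi z).
    have idT := add_gens_ideal IL' (mkseq t' i).
    have idJ : is_ideal (fun z => add_gens IL' (mkseq t' i) (psi z)).
      split=> [|y y' Iy Iy'|a y Iy]; rewrite ?rmorph0 ?rmorphD ?rmorphM.
      - exact: ideal0.
      - exact: idealD.
      - exact: ideal_mull.
    apply: (add_gens_min idJ) => y; first by move=> /proj_sr; apply: add_gens_sub.
    move=> /mapP[k]; rewrite mem_iota add0n => /andP[_ lt_k] ->.
    rewrite -phit' ?(ltn_trans lt_k) // -[psi _](subrK (t' k)); apply: idealD => //.
      by apply: add_gens_sub; apply: proj_liftK.
    by apply: add_gens_mem; apply/map_f; rewrite mem_iota.
  have idT := add_gens_ideal IL' (mkseq t' i).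
  rewrite -[x](subKr (psi (phi x))); apply: idealB => //.
    by apply: proj; apply: nzdT => //; rewrite -phit' // -rmorphM; apply: lift.
  by apply: add_gens_sub; apply: proj_liftK.
have t'_m i : (i < d1)%N -> irrelevant_ideal (t' i).
  by move=> lt_i; apply: esym_irrelevant; apply: leq_trans le_d1A.
exists d1; split; split.
(* The preimage of [F] in [A] is a face of [L'] with [d1] vertices and gives a prime chain of that
   length. *)
- have -> : d1 = #|[set y in A | r y \in F]|.
    rewrite -(card_in_imset (f := r)); last first.
      by move=> y y' /setIdP[Ay _] /setIdP[Ay' _]; apply: inj_r.
    congr #|pred_of_set _|; apply/setP => v; rewrite inE.
    apply/andP/imsetP => [[Fv /imsetP[y Ay vE]]|[y /setIdP[Ay Fy] ->]].
      by exists y => //; rewrite inE Ay -vE.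
    by rewrite Fy imset_f.
  apply: sr_prime_chain => //; rewrite isoL; last first.
    by apply/subsetP => y /setIdP[].
  case: complexL => _ /(_ _ _ LF); apply; apply/subsetP => v /imsetP[y /setIdP[_ Fy] ->] //.
- by move=> e; apply: prime_chain_le.
- exists T'; split.
  + by rewrite size_mkseq.
  + by move=> y /mapP[k]; rewrite mem_iota => /andP[_ lt_k] ->; apply: t'_m.
  + split.
      move=> i; rewrite size_mkseq => lt_i x.
      have -> : take i T' = mkseq t' i.
        by rewrite /T' /mkseq -map_take take_iota (minn_idPl (ltnW lt_i)).
      by rewrite nth_mkseq //; apply: nzdT'.
    move=> I1; have: @irrelevant_ideal K W 1.
      apply: (add_gens_min (@irrelevant_is_ideal K W)) I1 => y.
        by apply: sr_irrelevant; case: complexL'.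
      by move=> /mapP[k]; rewrite mem_iota => /andP[_ lt_k] ->; apply: t'_m.
    by move=> /irrelevant_const /eqP; rewrite mcoeff1 eqxx oner_eq0.
- by move=> e [s [<- _ reg]]; apply: (regular_seq_le leL' reg).
Qed.

End InducedSubcomplex.

(** * Links in contractions *)

Section Contraction.
Variables (V : finType) (D : {set {set V}}).
Hypothesis complexD : simplicial_complex D.
Implicit Types (S F H c : {set V}) (x y : V) (Y G : {set {set V}}).

Let C := vertex_classes D.
Let down S F : F \in D -> S \subset F -> S \in D.
Proof. by case: complexD => _; apply. Qed.

Lemma mem_star_join x S : (S \in star_join D x) = (x |: S \in D).
Proof.
apply/imset2P/idP => [[F G + + ->]|DxS].
  rewrite !inE => /exists_inP[_ /set1P-> sFx] /andP[_ /andP[_ DGx]].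
  apply: down DGx _; rewrite setUA [[set x] :|: F](setUidPl sFx).
  by rewrite setUC.
exists (S :&: [set x]) (S :\ x).
- by rewrite inE; apply/exists_inP; exists [set x]; rewrite ?set11 ?subsetIr.
- rewrite inE disjoint_sym disjoints1 setD11 /=; apply/andP; split.
    by apply: down DxS _; rewrite (subset_trans (subsetDl S [set x])) ?subsetUr.
  by apply: down DxS _; rewrite setUC setUS ?subsetDl.
- by rewrite setID.
Qed.

Let classesP : partition C (vertices D).
Proof.
apply: equivalence_partitionP => x y z _ _ _; split=> [|/eqP->] //; exact: eqxx.
Qed.

Lemma class_uniq c c' x : c \in C -> c' \in C -> x \in c -> x \in c' -> c = c'.
Proof.
move=> Cc Cc' cx c'x; have /and3P[_ tI _] := classesP.
by rewrite -(def_pblock tI Cc cx) (def_pblock tI Cc' c'x).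
Qed.

Lemma class_nonempty c : c \in C -> exists x, x \in c.
Proof. by move=> Cc; have /and3P[_ _ n0] := classesP; apply/set0Pn; apply: contraNneq n0 => <-. Qed.

Lemma class_twin c x y S : c \in C -> x \in c -> y \in c -> x |: S \in D ->
  y |: (x |: S) \in D.
Proof.
move=> /imsetP[z _ ->]; rewrite !inE => /andP[_ /eqP zx] /andP[_ /eqP zy] DxS.
by rewrite -mem_star_join -zy zx mem_star_join setUA setUid.
Qed.

Lemma facet_exists S : S \in D -> exists2 F, F \in facets D & S \subset F.
Proof.
move=> DS; pose P F := (F \in D) && (S \subset F).
have PS : P S by rewrite /P DS subxx.
case: (@arg_maxnP _ S P (fun F => #|F|) PS) => F /andP[DF sSF] maxF; exists F => //.
rewrite inE DF; apply/forall_inP => G DG; apply/implyP => sFG.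
by rewrite eqEcard sFG; apply: maxF; rewrite /P DG (subset_trans sSF).
Qed.

(** Vertices of one class have the same star, so a twin of a vertex of a facet can be added to the
    facet, and by maximality it is already there. *)
Lemma facet_class F c x : F \in facets D -> c \in C -> x \in c -> x \in F -> c \subset F.
Proof.
rewrite inE => /andP[DF /forall_inP maxF] Cc cx Fx; apply/subsetP => y cy.
have DyF : y |: F \in D.
  rewrite -[F in y |: F](setUidPr (_ : [set x] \subset F)) ?sub1set //.
  by apply: (class_twin Cc cx cy); rewrite (setUidPr _) ?sub1set.
have := implyP (maxF _ DyF) (subsetUr _ _) => /eqP->.
by rewrite !inE eqxx.
Qed.

(** Trades the facet description of the contraction for one of its faces, the form in which links in
    the two complexes can be compared. The converse direction extends the union to a facet. *)
Lemma mem_contraction Y : (Y \in contraction D) = (Y \subset C) && (cover Y \in D).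
Proof.
apply/idP/andP => [|[sYC DY]].
  rewrite inE => /exists_inP[_ /imsetP[F FF ->]] /subsetP sY.
  split; first by apply/subsetP => c /sY; rewrite inE => /andP[].
  move: FF; rewrite inE => /andP[DF _]; apply: down DF _.
  by apply/bigcupsP => c /sY; rewrite inE => /andP[].
have [F FF sYF] := facet_exists DY.
rewrite inE; apply/exists_inP; exists [set y in C | y \subset F]; first exact: imset_f.
apply/subsetP => c Yc; rewrite inE (subsetP sYC) //=.
exact: subset_trans (bigcup_sup c Yc) sYF.
Qed.

Lemma contraction_complex : simplicial_complex (contraction D).
Proof.
have [D0 _] := complexD.
split; first by rewrite mem_contraction sub0set /cover big_set0.
move=> Y Z; rewrite !mem_contraction => /andP[sZC DZ] sYZ.
rewrite (subset_trans sYZ) //=; apply: down DZ _; apply/bigcupsP => c Yc.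
by apply: bigcup_sup; apply: (subsetP sYZ).
Qed.

Definition inner_classes F := [set c in C | c \subset F].

Lemma cover_inner_classes F : F \in facets D -> cover (inner_classes F) = F.
Proof.
move=> FF; apply/setP => x; apply/bigcupP/idP => [[c]|Fx].
  by rewrite inE => /andP[_ /subsetP sub] /sub.
have Dx : x \in vertices D.
  move: FF; rewrite inE => /andP[DF _].
  by rewrite inE; apply: down DF _; rewrite sub1set.
have /and3P[/eqP covC tI _] := classesP; rewrite -covC in Dx.
exists (pblock C x); last by rewrite mem_pblock.
rewrite inE pblock_mem //=; apply: facet_class FF (pblock_mem Dx) _ Fx.
by rewrite mem_pblock.
Qed.

(** A face of the contraction containing all these classes has a union containing [F], hence equal
    to it. Through this lemma, purity of the contraction says that all facets of [D] contain equally
    many classes. *)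
Lemma inner_classes_facet F : F \in facets D -> inner_classes F \in facets (contraction D).
Proof.
move=> FF; have covF := cover_inner_classes FF.
have [DF maxF] : F \in D /\ forall H, H \in D -> F \subset H -> F = H.
  move: FF; rewrite inE => /andP[DF /forall_inP maxF]; split=> // H DH sFH.
  exact/eqP/(implyP (maxF H DH)).
rewrite inE mem_contraction covF DF andbT; apply/andP; split.
  by apply/subsetP => c; rewrite inE => /andP[].
apply/forall_inP => Z; rewrite mem_contraction => /andP[sZC DZ].
apply/implyP => sFZ; rewrite eqEsubset sFZ; apply/subsetP => c Zc.
rewrite inE (subsetP sZC) //= (maxF _ DZ); first exact: bigcup_sup.
rewrite -covF; apply/bigcupsP => c' Fc'; apply: bigcup_sup.
exact: (subsetP sFZ).
Qed.

End Contraction.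

Lemma link_complex (V : finType) (D : {set {set V}}) F :
  simplicial_complex D -> F \in D -> simplicial_complex (link D F).
Proof.
move=> [D0 down] DF; split; first by rewrite inE D0 -setI_eq0 set0I eqxx set0U.
move=> S T; rewrite !inE => /and3P[DT dT DTF] sST.
by rewrite (down S T) // (disjointWl sST dT) (down _ _ DTF) // setSU.
Qed.

Section LinkOfContraction.
Variables (K : fieldType) (V : finType) (D : {set {set V}}).
Hypotheses (complexD : simplicial_complex D) (pureD : pure D).
Hypothesis pureG : pure (contraction D).

Lemma cohen_macaulay_link_contraction (v0 : V) (G : {set {set V}}) :
    G \in contraction D ->
  cohen_macaulay K (link D (cover G)) -> cohen_macaulay K (link (contraction D) G).
Proof.
move=> GG; set F0 := cover G; pose C := vertex_classes D.
have down (S F : {set V}) : F \in D -> S \subset F -> S \in D by case: complexD => _; apply.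
have [sGC DF0] : G \subset C /\ F0 \in D by apply/andP; rewrite -mem_contraction.
(* The default [v0] is taken only at the empty set, which is not a class. *)
pose r (c : {set V}) := odflt v0 [pick x in c].
have rP c : c \in C -> r c \in c.
  move=> Cc; rewrite /r; case: pickP => //= c0.
  by have [x] := class_nonempty Cc; rewrite c0.
pose A := C :\: G; pose B := r @: A.
have subG (H : {set V}) : F0 \subset H -> G \subset inner_classes D H.
  move=> sF0H; apply/subsetP => c Gc; rewrite inE (subsetP sGC) //=.
  exact: subset_trans (bigcup_sup c Gc) sF0H.
have notF0 (c : {set V}) x : c \in A -> x \in c -> x \notin F0.
  move=> /setDP[Cc nGc] cx; apply/negP => /bigcupP[c' Gc' c'x].
  by rewrite (class_uniq Cc (subsetP sGC _ Gc') cx c'x) Gc' in nGc.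
(* A facet contains all or nothing of each class, so outside [F0] its vertices in [B] are the
   representatives of its classes not in [G]. *)
have facetB (H : {set V}) : H \in facets D -> F0 \subset H ->
    (H :\: F0) :&: B = r @: (inner_classes D H :\: G).
  move=> FH sF0H; apply/setP => x; apply/setIP/imsetP.
    case=> /setDP[Hx _] /imsetP[c /setDP[Cc nGc] xE]; exists c => //.
    rewrite inE nGc inE Cc /=; apply: (facet_class complexD FH Cc (rP _ Cc)).
    by rewrite -xE.
  case=> c /setDP[]; rewrite inE => /andP[Cc /subsetP scH] nGc ->.
  have Ac : c \in A by rewrite inE nGc.
  by rewrite inE (notF0 c) ?rP //= scH ?rP // imset_f.
have inj_r : {in A &, injective r}.
  move=> c c' /setDP[Cc _] /setDP[Cc' _] eq_r.
  by apply: (class_uniq Cc Cc' (rP _ Cc)); rewrite eq_r rP.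
have inj_rH H : {in inner_classes D H :\: G &, injective r}.
  move=> c c' /setDP[/setIdP[Cc _] nGc] /setDP[/setIdP[Cc' _] nGc'].
  by apply: inj_r; rewrite inE ?nGc ?nGc'.
have [H0 FH0 sFH0] := facet_exists DF0.
have DH0 : H0 \in D by move: FH0; rewrite inE => /andP[].
(* Purity of the contraction fixes the number of classes in [H], hence the count in [B]; purity of
   [D] fixes the total, hence the count outside [B]. *)
have cardB (H : {set V}) : H \in facets D -> F0 \subset H ->
   #|(H :\: F0) :&: B| = #|(H0 :\: F0) :&: B| /\ #|(H :\: F0) :\: B| = #|(H0 :\: F0) :\: B|.
  move=> FH sF0H.
  have eqI : #|(H :\: F0) :&: B| = #|(H0 :\: F0) :&: B|.
    rewrite !facetB // !card_in_imset; try exact: inj_rH.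
    rewrite !cardsD !(setIidPr (subG _ _)) //.
    by rewrite (pureG (inner_classes_facet complexD FH) (inner_classes_facet complexD FH0)).
  split=> //; rewrite ![#|_ :\: B|]cardsD eqI; congr (_ - _)%N.
  by rewrite !cardsD !(setIidPr _) // (pureD FH FH0).
apply: (@cohen_macaulay_induced K V _ _ _ r A _ _ _ inj_r _ (H0 :\: F0)).
- exact: link_complex.
- exact: link_complex (contraction_complex complexD) GG.
- move=> Y; rewrite inE !mem_contraction // => /andP[/andP[sYC _] /andP[dYG _]].
  by rewrite subsetD sYC.
- move=> Y sYA; have sYC : Y \subset C := subset_trans sYA (subsetDl _ _).
  rewrite [Y \in _]inE [r @: Y \in _]inE !mem_contraction // sYC /=.
  apply/and3P/and3P=> [[DY dYG /andP[_ DYG]]|[DrY dYF DrYF]].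
    have srY : r @: Y \subset cover Y.
      apply/subsetP => _ /imsetP[c Yc ->]; apply/bigcupP; exists c => //.
      by apply: rP; apply: (subsetP sYC).
    split; first exact: down DY srY.
      rewrite disjoint_subset; apply/subsetP => _ /imsetP[c Yc ->].
      by apply: (notF0 c); rewrite ?rP ?(subsetP sYC) ?(subsetP sYA).
    apply: down DYG _; rewrite subUset; apply/andP; split.
      apply: subset_trans srY _; apply/bigcupsP => c Yc.
      by apply: bigcup_sup; rewrite inE Yc.
    by apply/bigcupsP => c Gc; apply: bigcup_sup; rewrite inE Gc orbT.
  (* Passing to a facet turns the representatives back into whole classes. *)
  have [H FH] := facet_exists DrYF; rewrite subUset => /andP[srYH sF0H].
  have DH : H \in D by move: FH; rewrite inE => /andP[].
  have scH c : c \in Y -> c \subset H.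
    move=> Yc; have Cc := subsetP sYC _ Yc.
    by apply: (facet_class complexD FH Cc (rP _ Cc)); apply: (subsetP srYH); apply: imset_f.
  split; first by apply: down DH _; apply/bigcupsP.
    by move: sYA; rewrite subsetD => /andP[].
  rewrite subUset sYC sGC; apply: down DH _; apply/bigcupsP => c /setUP[/scH //|Gc].
  exact: subset_trans (bigcup_sup c Gc) sF0H.
- rewrite inE; apply/and3P; split; first by apply: down DH0 (subsetDl _ _).
    by rewrite disjoint_sym disjoint_subset; apply/subsetP => x F0x; rewrite !inE F0x.
  by apply: down DH0 _; rewrite subUset subsetDl.
- move=> H; rewrite inE => /and3P[DH dHF DHF].
  (* A face of the link lies in [H1 :\: F0] for a facet [H1] containing [F0], and there both counts
     agree with those of [H0]. *)
  have [H1 FH1] := facet_exists DHF; rewrite subUset => /andP[sHH1 sF0H1].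
  have [<- <-] := cardB _ FH1 sF0H1.
  have sH : H \subset H1 :\: F0 by rewrite subsetD sHH1.
  by split; apply: subset_leq_card; [apply: setSI | apply: setSD].
Qed.

End LinkOfContraction.

Theorem theorem4p6 (K : fieldType) (t : nat) (V : finType)
    (Delta : {set {set V}})
    (Delta_complex : simplicial_complex Delta)
    (Delta_CMt : CM K t Delta)
    (alpha_ge_t : forall k : nat, k \in contraction_vector Delta -> (t <= k)%N)
    (Gamma_pure : pure (contraction Delta)) :
  buchsbaum K (contraction Delta).
Proof.
have [pureD cmD] := Delta_CMt; split=> // G GG /card_gt0P[c Gc].
have [sGC DF0] : G \subset vertex_classes Delta /\ cover G \in Delta.
  by apply/andP; rewrite -mem_contraction.
have [v0 _] := class_nonempty (subsetP sGC _ Gc).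
apply: (cohen_macaulay_link_contraction Delta_complex pureD Gamma_pure v0 GG).
(* The union of [G] contains the class [c], which has at least [t] vertices by the assumption on the
   contraction vector. *)
apply: cmD => //; apply: leq_trans (subset_leq_card (bigcup_sup c Gc)).
by apply: alpha_ge_t; apply: map_f; rewrite mem_enum (subsetP sGC).
Qed.
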